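(* Let $\theta:\mathbb{Z}^d\to\mathbb{R}^d$ be an embedding. The space $Y_\theta$ is a Hilbert $L^\infty(\mathbb{T}^d)$-module when equipped with the Fourier transformed bracket product $[\![\cdot,\cdot]\!]_\theta$, with convergence in the weak* topology on $L^\infty(\mathbb{T}^d)$, and the associated module action $\widehat{\circ_\theta}$.
   Context: Conventions. $\mathbb{T}^d=\mathbb{R}^d/\mathbb{Z}^d$ with normalised Haar measure; $\widehat{\mathbb{R}^d}$ is the dual of $\mathbb{R}^d$, identified with $\mathbb{R}^d$ through $(x,\xi)=e^{2\pi i x\cdot\xi}$. $\iota:\mathbb{Z}^d\to\mathbb{R}^d$ is the natural inclusion and $\hat\iota:\widehat{\mathbb{R}^d}\to\mathbb{T}^d$ the quotient map. An embedding $\theta$ is an injective group homomorphism that is a homeomorphism onto its image; $A_\theta$ is the unique nonsingular linear map of $\mathbb{R}^d$ with $\theta=A_\theta\iota$, and $\hat\theta=\hat\iota A_\theta^*:\widehat{\mathbb{R}^d}\to\mathbb{T}^d$. Operations. $[\![p,q]\!]_\theta(\zeta)=\frac{1}{|\det A_\theta|}\sum_{\hat\theta(\xi)=\zeta}\overline{p(\xi)}q(\xi)$ for a.e. $\zeta\in\mathbb{T}^d$, i.e. $[\![p,q]\!]_\theta(\hat\theta(\xi))=\frac{1}{|\det A_\theta|}\sum_{\beta\in(A_\theta^* )^{-1}\mathbb{Z}^d}\overline{p(\xi+\beta)}q(\xi+\beta)$. For $b\in L^\infty(\mathbb{T}^d)$, $(p\,\widehat{\circ_\theta}\,b)(\xi)=p(\xi)b(\hat\theta(\xi))$.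 The space $Y_\theta$ is the set of measurable functions $p$ on $\widehat{\mathbb{R}^d}$ (modulo a.e. equality) for which $\|p\|_{Y_\theta}=\sqrt{\operatorname{ess\,sup}_{\zeta\in\mathbb{T}^d}[\![p,p]\!]_\theta(\zeta)}$ is finite. The series defining the bracket is required to converge only in the weak* topology of $L^\infty(\mathbb{T}^d)=L^1(\mathbb{T}^d)^*$. For a $C^*$-algebra $\mathcal{A}$, a Hilbert $\mathcal{A}$-module is a right $\mathcal{A}$-module $X$ (a linear space with compatible scalar multiplication) with an $\mathcal{A}$-valued inner product $[\cdot,\cdot]$, linear in the second variable, with $[x,ya]=[x,y]a$, $[x,y]^*=[y,x]$, $[x,x]\ge0$, $[x,x]=0\Rightarrow x=0$, complete for the norm $\|x\|=\|[x,x]\|^{1/2}$. *)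

(* Defs.v *)
From HB Require Import structures.
From mathcomp Require Import all_boot all_order all_algebra finmap.
From mathcomp Require Import complex lra.
From mathcomp Require Import all_classical all_reals all_analysis.
From mathcomp Require Import measurable_realfun ess_sup_inf.

Set Implicit Arguments.
Unset Strict Implicit.
Unset Printing Implicit Defensive.

Import Order.TTheory GRing.Theory Num.Theory.
Import numFieldNormedType.Exports.
Import ComplexField Normc.

Local Open Scope classical_set_scope.
Local Open Scope complex_scope.
Local Open Scope ring_scope.

(* The Borel sigma-algebra of C = R^2. *)
Section measurable_complex.
Variable R : realType.

Definition complex_of_pair (z : R * R) : R[i] := z.1 +i* z.2.

Definition measurableC_set : set (set R[i]) :=
  [set A | measurable (complex_of_pair @^-1` A)].

Let measurableC0 : measurableC_set set0.
Proof. by rewrite /measurableC_set /= preimage_set0. Qed.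

Let measurableCC A : measurableC_set A -> measurableC_set (~` A).
Proof. by rewrite /measurableC_set /= preimage_setC; exact: measurableC. Qed.

Let measurableC_bigcup (F : (set R[i])^nat) :
  (forall i, measurableC_set (F i)) -> measurableC_set (\bigcup_i F i).
Proof.
rewrite /measurableC_set /= preimage_bigcup => mF.
exact: bigcupT_measurable.
Qed.

HB.instance Definition _ := isPointed.Build R[i] 0.
HB.instance Definition _ := @isMeasurable.Build default_measure_display R[i]
  measurableC_set measurableC0 measurableCC measurableC_bigcup.

Lemma measurable_complex_of_pair : measurable_fun setT complex_of_pair.
Proof. by move=> _ A mA; rewrite setTI. Qed.

Lemma measurable_Re : measurable_fun setT (@complex.Re R).
Proof.
move=> _ A mA; rewrite setTI /measurable /= /measurableC_set /=.
have := @measurable_fst _ _ R R measurableT A mA.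
by rewrite setTI.
Qed.

Lemma measurable_Im : measurable_fun setT (@complex.Im R).
Proof.
move=> _ A mA; rewrite setTI /measurable /= /measurableC_set /=.
have := @measurable_snd _ _ R R measurableT A mA.
by rewrite setTI.
Qed.

Lemma measurable_funCP d (T : measurableType d) (f : T -> R[i]) :
  measurable_fun setT f <->
  measurable_fun setT (fun x => complex.Re (f x)) /\
  measurable_fun setT (fun x => complex.Im (f x)).
Proof.
split=> [mf|[mr mi]].
  split; apply: (measurableT_comp _ mf).
    exact: measurable_Re.
  exact: measurable_Im.
rewrite (_ : f = complex_of_pair \o
    (fun x => (complex.Re (f x), complex.Im (f x)))); last first.
  by apply/funext => x /=; rewrite /complex_of_pair /=; case: (f x).
apply: measurableT_comp; first exact: measurable_complex_of_pair.
exact: measurable_fun_pair.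
Qed.

End measurable_complex.

Section measurable_complex_ops.
Context d (T : measurableType d) (R : realType).
Implicit Types f g : T -> R[i].

Lemma measurable_addc f g : measurable_fun setT f -> measurable_fun setT g ->
  measurable_fun setT (fun x => f x + g x).
Proof.
move=> /measurable_funCP[fr fi] /measurable_funCP[gr gi].
apply/measurable_funCP; split.
- rewrite (_ : (fun x => _) =
    (fun x => complex.Re (f x) + complex.Re (g x))).
    exact: measurable_funD.
  by apply/funext => x; case: (f x) (g x) => [? ?] [? ?].
- rewrite (_ : (fun x => _) =
    (fun x => complex.Im (f x) + complex.Im (g x))).
    exact: measurable_funD.
  by apply/funext => x; case: (f x) (g x) => [? ?] [? ?].
Qed.

Lemma measurable_mulc f g : measurable_fun setT f -> measurable_fun setT g ->
  measurable_fun setT (fun x => f x * g x).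
Proof.
move=> /measurable_funCP[fr fi] /measurable_funCP[gr gi].
apply/measurable_funCP; split.
- rewrite (_ : (fun x => _) = (fun x => complex.Re (f x) * complex.Re (g x)
                                      - complex.Im (f x) * complex.Im (g x))).
    by apply: measurable_funB; exact: measurable_funM.
  by apply/funext => x; case: (f x) (g x) => [? ?] [? ?].
- rewrite (_ : (fun x => _) = (fun x => complex.Re (f x) * complex.Im (g x)
                                      + complex.Im (f x) * complex.Re (g x))).
    by apply: measurable_funD; exact: measurable_funM.
  by apply/funext => x; case: (f x) (g x) => [? ?] [? ?].
Qed.

Lemma measurable_conjc f : measurable_fun setT f ->
  measurable_fun setT (fun x => (f x)^*).
Proof.
move=> /measurable_funCP[fr fi]; apply/measurable_funCP; split.
- rewrite (_ : (fun x => _) = (fun x => complex.Re (f x)))//.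
  by apply/funext => x; case: (f x).
- rewrite (_ : (fun x => _) = \- (fun x => complex.Im (f x))).
    exact: measurableT_comp.
  by apply/funext => x /=; case: (f x).
Qed.

End measurable_complex_ops.

(* Complex measurable functions modulo equality almost everywhere; the ring and
   module operations are the pointwise ones, computed on representatives. *)
Definition L0 d (T : measurableType d) (R : realType)
    (mu : {measure set T -> \bar R}) : Type :=
  {mfun_ mu, T >-> R[i]}.

Section L0_theory.
Context d (T : measurableType d) (R : realType).
Variable mu : {measure set T -> \bar R}.
Local Notation C := R[i].
Local Notation L0mu := (L0 mu).

HB.instance Definition _ := Choice.on L0mu.

Definition L0_fun (f : L0mu) : T -> C := aqEqMfun_to_fun f.
Coercion L0_fun : L0 >-> Funclass.

Lemma measurable_L0 (f : L0mu) : measurable_fun setT f.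
Proof. exact: measurable_funPT. Qed.

Section mk.
Variables (f : T -> C) (mf : measurable_fun setT f).
#[local] HB.instance Definition _ := @isMeasurableFun.Build d _ T C f mf.
Definition mkL0 : L0mu :=
  \pi_(@aeEqMfun _ _ _ T C mu)%qT ([the {mfun T >-> C} of f] : {mfun T >-> C}).

Lemma mkL0E : \forall x \ae mu, mkL0 x = f x.
Proof.
have /eqP : mkL0 = \pi_(@aeEqMfun _ _ _ T C mu)%qT (f : {mfun T >-> C})
  :> @aeEqMfun _ _ _ T C mu by [].
rewrite -{1}[mkL0](@reprK _ (@aeEqMfun _ _ _ T C mu)) eqmodE => /asboolP.
by apply: filterS => x /(_ I).
Qed.

End mk.

Lemma L0P (f g : L0mu) : (\forall x \ae mu, f x = g x) <-> f = g.
Proof.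
split=> [fg|->]; last exact: aeW.
rewrite -[f](@reprK _ (@aeEqMfun _ _ _ T C mu)).
rewrite -[g](@reprK _ (@aeEqMfun _ _ _ T C mu)).
apply/eqP; rewrite eqmodE; apply/asboolP.
by apply: filterS fg => x fgx _.
Qed.

End L0_theory.

Section L0_algebra.
Context d (T : measurableType d) (R : realType).
Variable mu : {measure set T -> \bar R}.
Local Notation C := R[i].
Local Notation L0 := (L0 mu).
Implicit Types f g h : L0.

Lemma measurable_oppc (u : T -> C) : measurable_fun setT u ->
  measurable_fun setT (fun x => - u x).
Proof.
move=> mu'; rewrite (_ : (fun x => _) = (fun x => (-1) * u x)).
  by apply: measurable_mulc => //; exact: measurable_cst.
by apply/funext => x; rewrite mulN1r.
Qed.

Definition L0_zero : L0 := mkL0 mu (@measurable_cst _ _ _ _ setT (0 : C)).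
Definition L0_one : L0 := mkL0 mu (@measurable_cst _ _ _ _ setT (1 : C)).
Definition L0_add f g : L0 :=
  mkL0 mu (measurable_addc (measurable_L0 f) (measurable_L0 g)).
Definition L0_opp f : L0 := mkL0 mu (measurable_oppc (measurable_L0 f)).
Definition L0_mul f g : L0 :=
  mkL0 mu (measurable_mulc (measurable_L0 f) (measurable_L0 g)).
Definition L0_scale (a : C) f : L0 :=
  mkL0 mu (measurable_mulc (@measurable_cst _ _ _ _ setT a) (measurable_L0 f)).
Definition L0_conj f : L0 := mkL0 mu (measurable_conjc (measurable_L0 f)).

Let L0_addE f g : \forall x \ae mu, L0_add f g x = f x + g x.
Proof. exact: mkL0E. Qed.
Let L0_oppE f : \forall x \ae mu, L0_opp f x = - f x.
Proof. exact: mkL0E. Qed.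
Let L0_mulE f g : \forall x \ae mu, L0_mul f g x = f x * g x.
Proof. exact: mkL0E. Qed.
Let L0_scaleE a f : \forall x \ae mu, L0_scale a f x = a * f x.
Proof. exact: mkL0E. Qed.
Let L0_zeroE : \forall x \ae mu, L0_zero x = 0.
Proof. exact: mkL0E. Qed.
Let L0_oneE : \forall x \ae mu, L0_one x = 1.
Proof. exact: mkL0E. Qed.

Let L0_addA : associative L0_add.
Proof.
move=> f g h; apply/L0P; near=> x.
rewrite (near (L0_addE f (L0_add g h)) x)//.
rewrite (near (L0_addE g h) x)//.
rewrite (near (L0_addE (L0_add f g) h) x)//.
rewrite (near (L0_addE f g) x)//.
by rewrite addrA.
Unshelve. all: by end_near. Qed.

Let L0_addC : commutative L0_add.
Proof.
move=> f g; apply/L0P; near=> x.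
rewrite (near (L0_addE f g) x)//.
rewrite (near (L0_addE g f) x)//.
by rewrite addrC.
Unshelve. all: by end_near. Qed.

Let L0_add0 : left_id L0_zero L0_add.
Proof.
move=> f; apply/L0P; near=> x.
rewrite (near (L0_addE L0_zero f) x)//.
rewrite (near (L0_zeroE) x)//.
by rewrite add0r.
Unshelve. all: by end_near. Qed.

Let L0_addN : left_inverse L0_zero L0_opp L0_add.
Proof.
move=> f; apply/L0P; near=> x.
rewrite (near (L0_addE (L0_opp f) f) x)//.
rewrite (near (L0_oppE f) x)//.
rewrite (near (L0_zeroE) x)//.
by rewrite addNr.
Unshelve. all: by end_near. Qed.

HB.instance Definition _ :=
  GRing.isZmodule.Build L0 L0_addA L0_addC L0_add0 L0_addN.

Let L0_mulA : associative L0_mul.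
Proof.
move=> f g h; apply/L0P; near=> x.
rewrite (near (L0_mulE f (L0_mul g h)) x)//.
rewrite (near (L0_mulE g h) x)//.
rewrite (near (L0_mulE (L0_mul f g) h) x)//.
rewrite (near (L0_mulE f g) x)//.
by rewrite mulrA.
Unshelve. all: by end_near. Qed.

Let L0_mulC : commutative L0_mul.
Proof.
move=> f g; apply/L0P; near=> x.
rewrite (near (L0_mulE f g) x)//.
rewrite (near (L0_mulE g f) x)//.
by rewrite mulrC.
Unshelve. all: by end_near. Qed.

Let L0_mul1 : left_id L0_one L0_mul.
Proof.
move=> f; apply/L0P; near=> x.
rewrite (near (L0_mulE L0_one f) x)//.
rewrite (near (L0_oneE) x)//.
by rewrite mul1r.
Unshelve. all: by end_near. Qed.

Let L0_mulD : left_distributive L0_mul L0_add.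
Proof.
move=> f g h; apply/L0P; near=> x.
rewrite (near (L0_mulE (L0_add f g) h) x)//.
rewrite (near (L0_addE f g) x)//.
rewrite (near (L0_addE (L0_mul f h) (L0_mul g h)) x)//.
rewrite (near (L0_mulE f h) x)//.
rewrite (near (L0_mulE g h) x)//.
by rewrite mulrDl.
Unshelve. all: by end_near. Qed.

HB.instance Definition _ :=
  GRing.Zmodule_isComPzRing.Build L0 L0_mulA L0_mulC L0_mul1 L0_mulD.

Let L0_scaleA : forall a b f, L0_scale a (L0_scale b f) = L0_scale (a * b) f.
Proof.
move=> a b f; apply/L0P; near=> x.
rewrite (near (L0_scaleE a (L0_scale b f)) x)//.
rewrite (near (L0_scaleE b f) x)//.
rewrite (near (L0_scaleE (a * b) f) x)//.
by rewrite mulrA.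
Unshelve. all: by end_near. Qed.

Let L0_scale1 : left_id 1 L0_scale.
Proof.
move=> f; apply/L0P; near=> x.
rewrite (near (L0_scaleE 1 f) x)//.
by rewrite mul1r.
Unshelve. all: by end_near. Qed.

Let L0_scaleDr : right_distributive L0_scale +%R.
Proof.
move=> a f g; apply/L0P; near=> x.
rewrite (near (L0_scaleE a (f + g)) x)//.
rewrite (near (L0_addE f g) x)//.
rewrite (near (L0_addE (L0_scale a f) (L0_scale a g)) x)//.
rewrite (near (L0_scaleE a f) x)//.
rewrite (near (L0_scaleE a g) x)//.
by rewrite mulrDr.
Unshelve. all: by end_near. Qed.

Let L0_scaleDl : forall f, {morph L0_scale^~ f : a b / a + b}.
Proof.
move=> f a b; apply/L0P; near=> x.
rewrite (near (L0_scaleE (a + b) f) x)//.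
rewrite (near (L0_addE (L0_scale a f) (L0_scale b f)) x)//.
rewrite (near (L0_scaleE a f) x)//.
rewrite (near (L0_scaleE b f) x)//.
by rewrite mulrDl.
Unshelve. all: by end_near. Qed.

HB.instance Definition _ := GRing.Zmodule_isLmodule.Build C L0
  L0_scaleA L0_scale1 L0_scaleDr L0_scaleDl.


Lemma L0D f g : \forall x \ae mu, (f + g : L0) x = f x + g x.
Proof. exact: L0_addE. Qed.
Lemma L0N f : \forall x \ae mu, (- f : L0) x = - f x.
Proof. exact: L0_oppE. Qed.
Lemma L0M f g : \forall x \ae mu, (f * g : L0) x = f x * g x.
Proof. exact: L0_mulE. Qed.
Lemma L0Z a f : \forall x \ae mu, (a *: f : L0) x = a * f x.
Proof. exact: L0_scaleE. Qed.
Lemma L00 : \forall x \ae mu, (0 : L0) x = 0.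
Proof. exact: L0_zeroE. Qed.
Lemma L01 : \forall x \ae mu, (1 : L0) x = 1.
Proof. exact: L0_oneE. Qed.
Lemma L0J f : \forall x \ae mu, L0_conj f x = (f x)^*.
Proof. exact: mkL0E. Qed.

End L0_algebra.

Definition complete_for (R : realType) (V : zmodType) (N : V -> R)
    (X : set V) : Prop :=
  forall u : nat -> V, (forall n, X (u n)) ->
    (forall e, 0 < e -> exists k, forall m n, (k <= m)%N -> (k <= n)%N ->
       N (u m - u n) < e) ->
  exists2 l, X l & N (u n - l) @[n --> \oo] --> (0 : R).

HB.mixin Record isCStarAlgebra (R : realType) (A : Type)
    of GRing.Algebra R[i] A := {
  star : A -> A;
  cnorm : A -> R;
  starK : involutive star;
  starD : {morph star : x y / x + y};
  starZ : forall (a : R[i]) x, star (a *: x) = a^* *: star x;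
  starM : forall x y, star (x * y) = star y * star x;
  cnorm_eq0 : forall x, cnorm x = 0 -> x = 0;
  cnormD : forall x y, cnorm (x + y) <= cnorm x + cnorm y;
  cnormZ : forall (a : R[i]) x, cnorm (a *: x) = normc a * cnorm x;
  cnormM : forall x y, cnorm (x * y) <= cnorm x * cnorm y;
  cnorm_star : forall x, cnorm (star x * x) = cnorm x ^+ 2;
  cnorm_complete : complete_for cnorm setT
}.

(* Unital complex C*-algebras. *)
#[short(type=cstarAlgType)]
HB.structure Definition CStarAlgebra (R : realType) :=
  {A of GRing.Algebra R[i] A & isCStarAlgebra R A}.

Section normc_lemmas.
Variable R : realType.
Implicit Types z w : R[i].

Lemma normc_ge0 z : 0 <= normc z.
Proof. by case: z => a b; rewrite sqrtr_ge0. Qed.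

Lemma normcJ z : normc z^* = normc z.
Proof. by case: z => a b; rewrite /normc /= sqrrN. Qed.

Lemma normr_Re z : `|complex.Re z| <= normc z.
Proof.
by case: z => a b /=; rewrite -sqrtr_sqr ler_wsqrtr// lerDl sqr_ge0.
Qed.

Lemma normr_Im z : `|complex.Im z| <= normc z.
Proof.
by case: z => a b /=; rewrite -sqrtr_sqr ler_wsqrtr// lerDr sqr_ge0.
Qed.

Lemma normc_le_ReIm z : normc z <= `|complex.Re z| + `|complex.Im z|.
Proof.
case: z => a b /=; have ab0 : 0 <= `|a| + `|b| by rewrite addr_ge0.
rewrite -(ger0_norm ab0) -sqrtr_sqr ler_wsqrtr// sqrrD !real_normK ?num_real//.
by rewrite addrAC lerDl mulrn_wge0// mulr_ge0.
Qed.

Lemma ReB z w : complex.Re (z - w) = complex.Re z - complex.Re w.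
Proof. by case: z; case: w. Qed.

Lemma ImB z w : complex.Im (z - w) = complex.Im z - complex.Im w.
Proof. by case: z; case: w. Qed.

End normc_lemmas.

Section Linf.
Context d (T : measurableType d) (R : realType).
Variable mu : probability T R.
Local Notation L0 := (L0 mu).

Definition ess_norm (f : T -> R[i]) : \bar R :=
  ess_sup mu (fun x => (normc (f x))%:E).

Lemma ess_norm_leP (f : T -> R[i]) (r : R) :
  (ess_norm f <= r%:E)%E <-> \forall x \ae mu, normc (f x) <= r.
Proof.
split=> [/ess_supP|] h; last apply/ess_supP; by apply: filterS h => x.
Qed.

Definition Linf_pred : {pred L0} := [pred f : L0 | `[< (ess_norm f < +oo)%E >]].

Lemma Linf_predP (f : L0) : reflect
  (exists r : R, \forall x \ae mu, normc (f x) <= r) (f \in Linf_pred).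
Proof.
apply: (iffP (asboolP _)) => [|[r /ess_norm_leP]]; last first.
  by move=> /le_lt_trans; apply; exact: ltry.
case E : (ess_norm f) => [r| |]// _.
  by exists r; apply/ess_norm_leP; rewrite E.
by exists 0; apply/ess_norm_leP; rewrite E leNye.
Qed.

Let Linf_subring : subring_closed Linf_pred.
Proof.
split.
- apply/Linf_predP; exists 1; apply: filterS (L01 mu) => x ->.
  by rewrite normc1.
- move=> f g /Linf_predP[r hf] /Linf_predP[s hg]; apply/Linf_predP.
  exists (r + s); near=> x.
  rewrite (near (L0D f (- g)) x)// (near (L0N g) x)//.
  rewrite (le_trans (le_normcD _ _))// normcN lerD//.
    by near: x.
  by near: x.
- move=> f g /Linf_predP[r hf] /Linf_predP[s hg]; apply/Linf_predP.
  exists (r * s); near=> x.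
  rewrite (near (L0M f g) x)// normcM ler_pM ?normc_ge0//.
    by near: x.
  by near: x.
Unshelve. all: by end_near. Qed.

Let Linf_scale : GRing.scaler_closed Linf_pred.
Proof.
move=> a f /Linf_predP[r hf]; apply/Linf_predP.
exists (normc a * r); near=> x.
rewrite (near (L0Z a f) x)// normcM ler_wpM2l ?normc_ge0//.
by near: x.
Unshelve. all: by end_near. Qed.

HB.instance Definition _ := GRing.isSubringClosed.Build _ Linf_pred Linf_subring.
HB.instance Definition _ := GRing.isScaleClosed.Build _ _ Linf_pred Linf_scale.

Record Linf : Type := MkLinf {Linf_val :> L0; _ : Linf_val \in Linf_pred}.

HB.instance Definition _ := [isSub for Linf_val].
HB.instance Definition _ := [Choice of Linf by <:].
HB.instance Definition _ := 
  GRing.SubChoice_isSubComPzRing.Build _ _ Linf (subringClosedP _).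
HB.instance Definition _ := [SubZmodule_isSubLmodule of Linf by <:].

Lemma Linf_conj_subproof (f : Linf) : L0_conj f \in Linf_pred.
Proof.
case: f => f /= /Linf_predP[r hf]; apply/Linf_predP; exists r; near=> x.
rewrite (near (L0J f) x)// normcJ.
by near: x.
Unshelve. all: by end_near. Qed.

Definition Linf_star (f : Linf) : Linf := MkLinf (Linf_conj_subproof f).

Definition Linf_norm (f : Linf) : R := fine (ess_norm f).


Let mu_gt0 : (0 < mu [set: T])%E.
Proof. by have -> := probability_setT mu. Qed.

Lemma ess_norm_fin (f : Linf) : ess_norm f \is a fin_num.
Proof.
rewrite ge0_fin_numE; first by case: f => f /= /asboolP.
apply: ess_sup_gee; first exact: mu_gt0.
by apply: aeW => x; rewrite lee_fin normc_ge0.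
Qed.

Lemma Linf_normP (f : Linf) : \forall x \ae mu, normc (f x) <= Linf_norm f.
Proof. by apply/ess_norm_leP; rewrite fineK ?ess_norm_fin. Qed.

Lemma Linf_norm_le (f : Linf) (r : R) :
  (\forall x \ae mu, normc (f x) <= r) -> Linf_norm f <= r.
Proof. by move/ess_norm_leP; rewrite -[ess_norm f]fineK ?ess_norm_fin. Qed.

Lemma Linf_norm_ge0 (f : Linf) : 0 <= Linf_norm f.
Proof.
rewrite fine_ge0//; apply: ess_sup_gee; first exact: mu_gt0.
by apply: aeW => x; rewrite lee_fin normc_ge0.
Qed.

Lemma LinfP (f g : Linf) : (\forall x \ae mu, f x = g x) <-> f = g.
Proof. by split=> [/L0P fg|->]; [exact/val_inj|exact: aeW]. Qed.

Let Linf_one_neq0 : (1 : Linf) != 0.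
Proof.
apply/negP => /eqP/LinfP h.
have : \forall x \ae mu, False.
  near=> x.
  have : (1 : Linf) x = (0 : Linf) x by near: x.
  rewrite (near (L01 mu) x)// (near (L00 mu) x)// => /eqP.
  by rewrite oner_eq0.
have := @ae_properfilter_algebraOfSetsType _ _ _ mu mu_gt0.
by move=> mup /(@filter_ex _ _ mup)[].
Unshelve. all: by end_near. Qed.

HB.instance Definition _ := GRing.PzSemiRing_isNonZero.Build Linf Linf_one_neq0.

Let Linf_scaleAl (a : R[i]) (f g : Linf) : a *: (f * g) = (a *: f) * g.
Proof.
apply/LinfP; near=> x.
rewrite (near (L0Z a (\val f * \val g)) x)//.
rewrite (near (L0M (a *: \val f) (\val g)) x)//.
rewrite (near (L0M (\val f) (\val g)) x)// (near (L0Z a (\val f)) x)//.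
by rewrite mulrA.
Unshelve. all: by end_near. Qed.

HB.instance Definition _ := GRing.Lmodule_isLalgebra.Build R[i] Linf Linf_scaleAl.
HB.instance Definition _ := GRing.Lalgebra_isComAlgebra.Build R[i] Linf.

Let Linf_starK : involutive Linf_star.
Proof.
move=> f; apply/LinfP; near=> x.
rewrite (near (L0J (L0_conj (\val f))) x)// (near (L0J (\val f)) x)//.
exact: conjcK.
Unshelve. all: by end_near. Qed.

Let Linf_starD : {morph Linf_star : f g / f + g}.
Proof.
move=> f g; apply/LinfP; near=> x.
rewrite (near (L0J (\val f + \val g)) x)// (near (L0D (\val f) (\val g)) x)//.
rewrite (near (L0D (L0_conj (\val f)) (L0_conj (\val g))) x)//.
rewrite (near (L0J (\val f)) x)// (near (L0J (\val g)) x)//.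
exact: rmorphD.
Unshelve. all: by end_near. Qed.

Let Linf_starZ (a : R[i]) f : Linf_star (a *: f) = a^* *: Linf_star f.
Proof.
apply/LinfP; near=> x.
rewrite (near (L0J (a *: \val f)) x)// (near (L0Z a (\val f)) x)//.
rewrite (near (L0Z a^* (L0_conj (\val f))) x)// (near (L0J (\val f)) x)//.
exact: rmorphM.
Unshelve. all: by end_near. Qed.

Let Linf_starM f g : Linf_star (f * g) = Linf_star g * Linf_star f.
Proof.
apply/LinfP; near=> x.
rewrite (near (L0J (\val f * \val g)) x)// (near (L0M (\val f) (\val g)) x)//.
rewrite (near (L0M (L0_conj (\val g)) (L0_conj (\val f))) x)//.
rewrite (near (L0J (\val f)) x)// (near (L0J (\val g)) x)// [RHS]mulrC.
exact: rmorphM.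
Unshelve. all: by end_near. Qed.

Let Linf_norm_eq0 f : Linf_norm f = 0 -> f = 0.
Proof.
move=> f0; apply/LinfP; near=> x.
rewrite (near (L00 mu) x)//; apply: eq0_normc; apply/eqP.
rewrite eq_le normc_ge0 andbT -f0.
by near: x; exact: Linf_normP.
Unshelve. all: by end_near. Qed.

Let Linf_normD f g : Linf_norm (f + g) <= Linf_norm f + Linf_norm g.
Proof.
apply: Linf_norm_le; near=> x.
rewrite (near (L0D (\val f) (\val g)) x)//.
by rewrite (le_trans (le_normcD _ _))// lerD//; near: x; exact: Linf_normP.
Unshelve. all: by end_near. Qed.

Let Linf_normZ (a : R[i]) f : Linf_norm (a *: f) = normc a * Linf_norm f.
Proof.
apply/eqP; rewrite eq_le; apply/andP; split.
  apply: Linf_norm_le; near=> x.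
  rewrite (near (L0Z a (\val f)) x)// normcM ler_wpM2l ?normc_ge0//.
  by near: x; exact: Linf_normP.
have [->|a0] := eqVneq a 0; first by rewrite normc0 mul0r Linf_norm_ge0.
have na0 : 0 < normc a.
  rewrite lt_neqAle normc_ge0 andbT eq_sym.
  by apply: contra_neq a0; exact: eq0_normc.
rewrite -ler_pdivlMl//; apply: Linf_norm_le; near=> x.
rewrite ler_pdivlMl// -normcM -(near (L0Z a (\val f)) x)//.
by near: x; exact: (Linf_normP (a *: f)).
Unshelve. all: by end_near. Qed.

Let Linf_normM f g : Linf_norm (f * g) <= Linf_norm f * Linf_norm g.
Proof.
apply: Linf_norm_le; near=> x.
rewrite (near (L0M (\val f) (\val g)) x)// normcM.
by rewrite ler_pM ?normc_ge0//; near: x; exact: Linf_normP.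
Unshelve. all: by end_near. Qed.

Let Linf_norm_star f : Linf_norm (Linf_star f * f) = Linf_norm f ^+ 2.
Proof.
apply/eqP; rewrite eq_le; apply/andP; split.
  apply: Linf_norm_le; near=> x.
  rewrite (near (L0M (L0_conj (\val f)) (\val f)) x)//.
  rewrite (near (L0J (\val f)) x)// normcM normcJ [leRHS]expr2.
  by rewrite ler_pM ?normc_ge0//; near: x; exact: Linf_normP.
rewrite -[leRHS]sqr_sqrtr ?Linf_norm_ge0//.
rewrite lerXn2r ?nnegrE ?sqrtr_ge0 ?Linf_norm_ge0//.
apply: Linf_norm_le; near=> x.
rewrite -[leLHS]ger0_norm ?normc_ge0// -sqrtr_sqr ler_wsqrtr//.
rewrite expr2 -{1}normcJ -normcM -(near (L0J (\val f)) x)//.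
rewrite -(near (L0M (L0_conj (\val f)) (\val f)) x)//.
by near: x; exact: (Linf_normP (Linf_star f * f)).
Unshelve. all: by end_near. Qed.


Let Linf_complete : complete_for Linf_norm setT.
Proof.
move=> u _ uC.
have uE : \forall x \ae mu, forall m n,
    normc (u m x - u n x) <= Linf_norm (u m - u n).
  apply: ae_foralln => m; apply: ae_foralln => n; near=> x.
  rewrite -(near (L0N (\val (u n))) x)//.
  rewrite -(near (L0D (\val (u m)) (- \val (u n))) x)//.
  by near: x; exact: (Linf_normP (u m - u n)).
pose lsup (v : R^nat) : R := fine (limn_esup (EFin \o v)).
pose l x : R[i] := lsup (fun n => complex.Re (u n x)) +i*
                   lsup (fun n => complex.Im (u n x)).
have ml : measurable_fun setT l.
  apply/measurable_funCP; split => /=.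
    apply: (measurableT_comp (fine_measurable measurableT)).
    apply: measurable_fun_limn_esup => n; apply/measurable_EFinP.
    by have /measurable_funCP[] := measurable_L0 (u n).
  apply: (measurableT_comp (fine_measurable measurableT)).
  apply: measurable_fun_limn_esup => n; apply/measurable_EFinP.
  by have /measurable_funCP[] := measurable_L0 (u n).
have lsup_cvg (v : R^nat) : (forall e, 0 < e -> exists k, forall m n,
    (k <= m)%N -> (k <= n)%N -> `|v m - v n| < e) -> v @ \oo --> lsup v.
  move=> vC; have : cvgn v.
    apply/cauchy_cvgP/cauchy_exP => e e0; have [k vk] := vC _ e0.
    by exists (v k); exists k => // n /= kn; exact: vk.
  move=> /cvg_ex[a va]; rewrite (_ : lsup v = a)//.
  have /cvg_limn_einf_sup[_] : EFin \o v @ \oo --> a%:E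
    by apply/fine_cvgP; split; [exact: nearW|exact: va].
  by rewrite /lsup => ->.
have dist_lim (v : R^nat) (a b e : R) : v @ \oo --> b ->
    (\forall p \near \oo, `|a - v p| <= e) -> `|a - b| <= e.
  move=> /cvgrPdist_le vb va; apply/ler_addgt0Pr => f /vb {}vb.
  have [p [vbp vap]] := filter_ex (filterI vb va).
  rewrite (_ : a - b = (a - v p) - (b - v p)); last lra.
  by rewrite (le_trans (ler_normB _ _))// lerD.
have lE e k : 0 < e -> (forall m n, (k <= m)%N -> (k <= n)%N ->
    Linf_norm (u m - u n) < e) ->
  forall n, (k <= n)%N -> \forall x \ae mu, normc (u n x - l x) <= e + e.
  move=> e0 uk n kn; apply: filterS uE => x ux.
  have reC : (fun n => complex.Re (u n x)) @ \oo --> complex.Re (l x).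
    apply: lsup_cvg => f /uC[j uj]; exists j => p q jp jq.
    rewrite -ReB; apply: le_lt_trans (uj _ _ jp jq).
    exact: le_trans (normr_Re _) (ux _ _).
  have imC : (fun n => complex.Im (u n x)) @ \oo --> complex.Im (l x).
    apply: lsup_cvg => f /uC[j uj]; exists j => p q jp jq.
    rewrite -ImB; apply: le_lt_trans (uj _ _ jp jq).
    exact: le_trans (normr_Im _) (ux _ _).
  apply: (le_trans (normc_le_ReIm _)); rewrite ReB ImB lerD//.
    apply: (dist_lim _ _ _ _ reC); exists k => // p kp; rewrite -ReB.
    exact: le_trans (normr_Re _) (le_trans (ux _ _) (ltW (uk _ _ kn kp))).
  apply: (dist_lim _ _ _ _ imC); exists k => // p kp; rewrite -ImB.
  exact: le_trans (normr_Im _) (le_trans (ux _ _) (ltW (uk _ _ kn kp))).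
have lb : mkL0 mu ml \in Linf_pred.
  have [k uk] := uC _ ltr01.
  apply/Linf_predP; exists (Linf_norm (u k) + (1 + 1)); near=> x.
  rewrite (near (mkL0E mu ml) x)//.
  rewrite (_ : l x = u k x - (u k x - l x)); last by rewrite subKr.
  rewrite (le_trans (le_normcD _ _))// lerD//.
    by near: x; exact: Linf_normP.
  by rewrite normcN; near: x; exact: (lE _ _ ltr01 uk _ (leqnn k)).
exists (MkLinf lb) => //; apply/cvgr0Pnorm_lt => e e0.
have e3 : 0 < e / 3 by rewrite divr_gt0.
have [k uk] := uC _ e3; exists k => // n /= kn.
rewrite ger0_norm ?Linf_norm_ge0//; apply: (@le_lt_trans _ _ (e / 3 + e / 3)).
  apply: Linf_norm_le; near=> x.
  rewrite (near (L0D (\val (u n)) (- mkL0 mu ml)) x)//.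
  rewrite (near (L0N (mkL0 mu ml)) x)// (near (mkL0E mu ml) x)//.
  by near: x; exact: (lE _ _ e3 uk _ kn).
lra.
Unshelve. all: by end_near. Qed.

HB.instance Definition _ := isCStarAlgebra.Build R Linf
  Linf_starK Linf_starD Linf_starZ Linf_starM Linf_norm_eq0 Linf_normD
  Linf_normZ Linf_normM Linf_norm_star Linf_complete.

End Linf.

(* The Borel sigma-algebra of R^d, generated by the coordinates. *)
Section measurable_cV.
Variables (R : realType) (d : nat).

Definition cV_coord (i : 'I_d) (x : 'cV[R]_d) : R := x i 0.

Let cV_set0 : g_sigma_preimage cV_coord set0.
Proof. exact: sigma_algebra0. Qed.

Let cV_setC A : g_sigma_preimage cV_coord A -> g_sigma_preimage cV_coord (~` A).
Proof. exact: sigma_algebraC. Qed.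

Let cV_bigcup (F : (set 'cV[R]_d)^nat) :
  (forall i, g_sigma_preimage cV_coord (F i)) ->
  g_sigma_preimage cV_coord (\bigcup_i F i).
Proof. exact: sigma_algebra_bigcup. Qed.

HB.instance Definition _ := @isMeasurable.Build default_measure_display
  'cV[R]_d (g_sigma_preimage cV_coord) cV_set0 cV_setC cV_bigcup.

Lemma measurable_coord (i : 'I_d) :
  measurable_fun setT (fun x : 'cV[R]_d => x i 0).
Proof.
move=> _ Y mY; rewrite setTI; apply: sub_sigma_algebra => /=.
rewrite -bigcup_seq/=; exists i => /=; first by rewrite mem_index_enum.
by exists Y => //; rewrite setTI.
Qed.

Lemma measurable_fun_cVP d' (T : measurableType d') (f : T -> 'cV[R]_d) :
  measurable_fun setT f <-> forall i, measurable_fun setT (fun x => f x i 0).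
Proof.
split=> [mf i|mf]; first exact: (measurableT_comp (measurable_coord i)).
move=> _ A mA; rewrite setTI; move: A mA.
apply: smallest_sub.
  split => [|A|F]; rewrite ?preimage_set0 //= => h.
  - by rewrite setTD preimage_setC; exact: measurableC.
  - by rewrite preimage_bigcup; exact: bigcupT_measurable.
move=> A; rewrite -bigcup_seq/= => -[i _ [B mB <-]].
by rewrite setTI -[X in measurable X]setTI; exact: mf.
Qed.

End measurable_cV.

Section lebesgue_cV.
Variable R : realType.

Definition cV_cons d (p : R * 'cV[R]_d) : 'cV[R]_d.+1 :=
  \col_i if unlift ord0 i is Some j then p.2 j 0 else p.1.

Definition cV_uncons d (x : 'cV[R]_d.+1) : R * 'cV[R]_d :=
  (x ord0 0, \col_j x (lift ord0 j) 0).

Lemma cV_consK d : cancel (@cV_cons d) (@cV_uncons d).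
Proof.
move=> [a v]; congr pair; rewrite ?mxE ?unlift_none//.
by apply/colP => i; rewrite !mxE liftK.
Qed.

Lemma measurable_cV_cons d : measurable_fun setT (@cV_cons d).
Proof.
apply/measurable_fun_cVP => i.
have [j ->|->] := unliftP ord0 i.
  rewrite (_ : (fun _ => _) = (fun p : R * 'cV[R]_d => p.2 j 0)).
    exact: (measurableT_comp (measurable_coord j) measurable_snd).
  by apply/funext => p; rewrite mxE liftK.
rewrite (_ : (fun _ => _) = fst)//.
by apply/funext => p; rewrite mxE unlift_none.
Qed.

Lemma measurable_cV_uncons d : measurable_fun setT (@cV_uncons d).
Proof.
apply: measurable_fun_pair; first exact: measurable_coord.
apply/measurable_fun_cVP => i.
rewrite (_ : (fun _ => _) = (fun x : 'cV[R]_d.+1 => x (lift ord0 i) 0)).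
  exact: measurable_coord.
by apply/funext => x; rewrite mxE.
Qed.

Section step.
Variables (d : nat) (m : {sigma_finite_measure set 'cV[R]_d -> \bar R}).

Definition lebesgue_cVS : set 'cV[R]_d.+1 -> \bar R :=
  pushforward (lebesgue_measure \x m)%E (@cV_cons d).

HB.instance Definition _ := Measure.copy lebesgue_cVS
  (measure_function_pushforward__canonical__measure_function_Measure
     (lebesgue_measure \x m)%E (@measurable_cV_cons d)).

Let lebesgue_cVS_sigma_finite : sigma_finite setT lebesgue_cVS.
Proof.
have /sigma_finiteP[F [FT ndF Foo]] := sigma_finiteT (@lebesgue_measure R).
have /sigma_finiteP[G [GT ndG Goo]] := sigma_finiteT m.
have consI (A : set (R * 'cV[R]_d)) :
    @cV_cons d @^-1` (@cV_uncons d @^-1` A) = A.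
  by rewrite -comp_preimage; apply/seteqP; split => x /=; rewrite cV_consK.
exists (fun n => @cV_uncons d @^-1` (F n `*` G n)).
  apply/seteqP; split=> // x _.
  have [k _ Fk] : (\bigcup_n F n) (cV_uncons x).1 by rewrite -FT.
  have [l _ Gl] : (\bigcup_n G n) (cV_uncons x).2 by rewrite -GT.
  exists (maxn k l) => //; split.
    exact: (subsetPset _ _ (ndF _ _ (leq_maxl k l))).
  exact: (subsetPset _ _ (ndG _ _ (leq_maxr k l))).
move=> n; have [mF Fy] := Foo n; have [mG Gy] := Goo n; split.
  rewrite -[X in measurable X]setTI; apply: measurable_cV_uncons => //.
  exact: measurableX.
rewrite /lebesgue_cVS /pushforward consI product_measure1E//.
by rewrite lte_mul_pinfty// ge0_fin_numE.
Qed.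

HB.instance Definition _ := Measure_isSigmaFinite.Build _ _ _ lebesgue_cVS
  lebesgue_cVS_sigma_finite.

End step.

(* Lebesgue measure on R^d. *)
Fixpoint lebesgue_cV d : {sigma_finite_measure set 'cV[R]_d -> \bar R} :=
  if d is d'.+1 then lebesgue_cVS (lebesgue_cV d') else \d_(0 : 'cV[R]_0).

Definition unit_cube d : set 'cV[R]_d := [set x | forall i, 0 <= x i 0 < 1].

Lemma measurable_unit_cube d : measurable (@unit_cube d).
Proof.
rewrite (_ : @unit_cube d =
    \bigcap_(i in [set: 'I_d]) (fun x : 'cV[R]_d => x i 0) @^-1` `[0, 1[).
  apply: fin_bigcap_measurable => // i _.
  by rewrite -[X in measurable X]setTI; exact: measurable_coord.
apply/seteqP; split=> x /= xC i; last by have := xC i I; rewrite /= in_itv.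
by move=> _; rewrite /= in_itv/=; exact: xC.
Qed.

Lemma lebesgue_cV_unit_cube d : lebesgue_cV d (@unit_cube d) = 1%E.
Proof.
elim: d => [|d IH] /=; first by rewrite diracE mem_set// => -[].
rewrite /lebesgue_cVS /pushforward (_ : _ @^-1` _ = `[0, 1[ `*` @unit_cube d).
  rewrite product_measure1E//; last exact: measurable_unit_cube.
  rewrite -[X in (_ * X)%E]/(lebesgue_cV d (@unit_cube d)) IH mule1.
  by rewrite /= lebesgue_measure_itv/= lte_fin ltr01 oppr0 adde0.
apply/seteqP; split=> -[a v] /=.
  move=> h; split=> /=.
    by have := h ord0; rewrite mxE unlift_none /= in_itv.
  by move=> i; have := h (lift ord0 i); rewrite mxE liftK.
move=> [a01 vC] i; rewrite mxE; case: unliftP => [j _|_] /=; first exact: vC.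
by move: a01; rewrite in_itv.
Qed.

End lebesgue_cV.

(* The torus R^d / Z^d, with the quotient Borel sigma-algebra. *)
Section torus.
Variables (R : realType) (d : nat).

Definition eq_modZ (x y : 'cV[R]_d) : bool :=
  [forall i, x i 0 - y i 0 \is a Num.int].

Let eq_modZ_refl : reflexive eq_modZ.
Proof. by move=> x; apply/forallP => i; rewrite subrr rpred0. Qed.

Let eq_modZ_sym : symmetric eq_modZ.
Proof. by move=> x y; apply: eq_forallb => i; rewrite -opprB rpredN. Qed.

Let eq_modZ_trans : transitive eq_modZ.
Proof.
move=> y x z /forallP xy /forallP yz; apply/forallP => i.
by rewrite -(subrKA (y i 0)) rpredD.
Qed.

Canonical eq_modZ_equiv := EquivRel eq_modZ eq_modZ_refl eq_modZ_sym eq_modZ_trans.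

Definition torus : Type := {eq_quot eq_modZ}%qT.
HB.instance Definition _ := Choice.on torus.
HB.instance Definition _ := EqQuotient.on torus.

Definition to_torus (x : 'cV[R]_d) : torus := (\pi_torus x)%qT.

Lemma to_torusP (x y : 'cV[R]_d) :
  to_torus x = to_torus y <-> forall i, x i 0 - y i 0 \is a Num.int.
Proof. by split=> [/eqmodP/forallP//|xy]; exact/eqmodP/forallP. Qed.

Definition torus_measurable : set (set torus) :=
  [set A | measurable (to_torus @^-1` A)].

Let torus_measurable0 : torus_measurable set0.
Proof. by rewrite /torus_measurable /= preimage_set0. Qed.

Let torus_measurableC A : torus_measurable A -> torus_measurable (~` A).
Proof. by rewrite /torus_measurable /= preimage_setC; exact: measurableC. Qed.

Let torus_measurable_bigcup (F : (set torus)^nat) :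
  (forall i, torus_measurable (F i)) -> torus_measurable (\bigcup_i F i).
Proof.
rewrite /torus_measurable /= preimage_bigcup => mF.
exact: bigcupT_measurable.
Qed.

HB.instance Definition _ := isPointed.Build torus (to_torus 0).
HB.instance Definition _ := @isMeasurable.Build default_measure_display torus
  torus_measurable torus_measurable0 torus_measurableC torus_measurable_bigcup.

Lemma measurable_to_torus : measurable_fun setT to_torus.
Proof. by move=> _ A mA; rewrite setTI. Qed.

(* Normalised Haar measure: the unit cube is a fundamental domain of Z^d. *)
Definition haar : set torus -> \bar R :=
  pushforward (mrestr (lebesgue_cV R d) (@measurable_unit_cube R d)) to_torus.

HB.instance Definition _ := Measure.copy haar
  (measure_function_pushforward__canonical__measure_function_Measure
     (mrestr (lebesgue_cV R d) (@measurable_unit_cube R d))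
     measurable_to_torus).

Let haarT : haar setT = 1%E.
Proof.
rewrite /haar /pushforward preimage_setT /mrestr setTI.
exact: lebesgue_cV_unit_cube.
Qed.

HB.instance Definition _ := Measure_isProbability.Build _ _ _ haar haarT.

End torus.

Arguments haar : clear implicits.

Definition topological_embedding (S T : topologicalType) (f : S -> T) : Prop :=
  [/\ injective f, continuous f &
      forall V, open V -> exists2 U, open U & f @` V = U `&` range f].

Section hilbert_module.
Variables (R : realType) (A : cstarAlgType R).

Definition cstar_positive (a : A) : Prop := exists b, a = star b * b.

(* X, a subset of the vector space V, is a Hilbert A-module for the right
   action act and the inner product ip. *)
Record hilbert_module (V : lmodType R[i]) (X : set V)
    (act : V -> A -> V) (ip : V -> V -> A) : Prop := HilbertModule {
  hm_0 : X 0;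
  hm_add : forall x y, X x -> X y -> X (x + y);
  hm_scale : forall (c : R[i]) x, X x -> X (c *: x);
  hm_act : forall x a, X x -> X (act x a);
  hm_actDl : forall x y a, X x -> X y -> act (x + y) a = act x a + act y a;
  hm_actDr : forall x a b, X x -> act x (a + b) = act x a + act x b;
  hm_actA : forall x a b, X x -> act x (a * b) = act (act x a) b;
  hm_act1 : forall x, X x -> act x 1 = x;
  hm_actZl : forall (c : R[i]) x a, X x -> act (c *: x) a = c *: act x a;
  hm_actZr : forall (c : R[i]) x a, X x -> act x (c *: a) = c *: act x a;
  hm_ipD : forall x y z, X x -> X y -> X z -> ip x (y + z) = ip x y + ip x z;
  hm_ipZ : forall (c : R[i]) x y, X x -> X y -> ip x (c *: y) = c *: ip x y;
  hm_ip_act : forall x y a, X x -> X y -> ip x (act y a) = ip x y * a;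
  hm_ip_star : forall x y, X x -> X y -> star (ip x y) = ip y x;
  hm_ip_ge0 : forall x, X x -> cstar_positive (ip x x);
  hm_ip_eq0 : forall x, X x -> ip x x = 0 -> x = 0;
  hm_complete : complete_for (fun x => Num.sqrt (cnorm (ip x x))) X
}.

End hilbert_module.

Section sums.
Variables (R : realType) (I : choiceType).

(* Convergence along the directed set of finite subsets of D. *)
Definition fset_cvg (D : set I) (S : {fset I} -> R[i]) (s : R[i]) : Prop :=
  forall e : R, 0 < e -> exists2 F0 : {fset I}, [set` F0] `<=` D &
    forall F : {fset I}, (F0 `<=` F)%fset -> [set` F] `<=` D ->
      normc (S F - s) < e.

Definition has_sum (D : set I) (f : I -> R[i]) (s : R[i]) : Prop :=
  fset_cvg D (fun F => \sum_(i <- F) f i) s.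

End sums.

Section weak_star.
Context d (T : measurableType d) (R : realType).
Variable mu : probability T R.

Definition cintegral (f : T -> R[i]) : R[i] :=
  (\int[mu]_x complex.Re (f x)) +i* (\int[mu]_x complex.Im (f x)).

Definition cintegrable (f : T -> R[i]) : Prop :=
  mu.-integrable setT (EFin \o (fun x => complex.Re (f x))) /\
  mu.-integrable setT (EFin \o (fun x => complex.Im (f x))).

(* The series of the u i converges unconditionally to b in the weak* topology
   of L^oo = (L^1)^*. *)
Definition weak_star_sum (I : choiceType) (u : I -> Linf mu) (b : Linf mu) :
    Prop :=
  forall g : T -> R[i], cintegrable g ->
    fset_cvg setT
      (fun F => cintegral (fun x => (\sum_(i <- F) u i : Linf mu) x * g x))
      (cintegral (fun x => b x * g x)).

End weak_star.

Section bracket.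
Variables (R : realType) (d : nat).
Local Notation Rd := 'cV[R]_d.
Local Notation Zd := 'cV[int]_d.
Local Notation Td := (torus R d).
Local Notation L0 := (L0 (lebesgue_cV R d)).
Local Notation Linf := (Linf (haar R d)).
Variable theta : {additive Zd -> Rd}.

Definition Zd_embedding : Prop :=
  @topological_embedding (discrete_topology Zd) Rd theta.

Definition Zd_incl (k : Zd) : Rd := map_mx intr k.

(* theta = A_theta Zd_incl holds for every additive theta (thetaE), and this matrix
   is the only one with that property; it is nonsingular when theta is an
   embedding. *)
Definition A_theta : 'M[R]_d := \matrix_(i, j) theta (delta_mx j 0) i 0.

Lemma thetaE k : theta k = A_theta *m Zd_incl k.
Proof.
apply/colP => i; rewrite [in LHS](matrix_sum_delta k) raddf_sum summxE mxE.
apply: eq_bigr => j _; rewrite big_ord1 !mxE -[k j ord0]intz scaler_int.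
by rewrite raddfMz -scaler_int mxE mulrC intz.
Qed.

Lemma A_theta_unique (B : 'M[R]_d) :
  (forall k, theta k = B *m Zd_incl k) -> B = A_theta.
Proof.
move=> thB; apply/matrixP => i j; rewrite [RHS]mxE thB mxE (bigD1 j)//= !mxE.
rewrite !eqxx mulr1 big1 ?addr0// => l lj.
by rewrite !mxE (negbTE lj) mulr0.
Qed.

(* The adjoint of A_theta for the pairing exp(2 i pi x . xi) is its transpose. *)
Definition theta_hat (xi : Rd) : Td := to_torus (A_theta^T *m xi).

Lemma measurable_theta_hat : measurable_fun setT theta_hat.
Proof.
apply: (measurableT_comp (@measurable_to_torus R d)).
apply/measurable_fun_cVP => i.
rewrite (_ : (fun _ => _) =
    (fun x : Rd => \sum_(j < d) A_theta^T i j * x j 0)); last first.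
  by apply/funext => x; rewrite mxE.
apply: measurable_sum => j; apply: measurable_funM => //.
exact: measurable_coord.
Qed.

Definition fiber (zeta : Td) : set Rd := [set xi | theta_hat xi = zeta].

Definition bracket_term (p q : Rd -> R[i]) (xi : Rd) : R[i] :=
  (`|\det A_theta|^-1)%:C * ((p xi)^* * q xi).

(* The class of any essentially bounded function whose value at almost every
   zeta is the unconditional sum of the series over the fiber of zeta. *)
Definition bracket (p q : L0) : Linf :=
  xget 0 [set b : Linf | \forall zeta \ae haar R d,
    has_sum (fiber zeta) (bracket_term p q) (b zeta)].

Definition Y_norm (p : L0) : \bar R :=
  (ess_sup (haar R d) (fun zeta => (`|\det A_theta|^-1)%:E *
     \esum_(xi in fiber zeta) (normc (p xi) ^+ 2)%:E) `^ 2^-1)%E.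

Definition Y_theta : set L0 := [set p | (Y_norm p < +oo)%E].

Definition pull_theta_hat (b : Linf) : L0 :=
  mkL0 (lebesgue_cV R d)
    (measurableT_comp (measurable_L0 (\val b)) measurable_theta_hat).

Definition module_action (p : L0) (b : Linf) : L0 := p * pull_theta_hat b.

Definition theta_section (s : Td -> Rd) : Prop :=
  measurable_fun setT s /\ forall zeta, theta_hat (s zeta) = zeta.

(* The terms of the bracket series, as functions on the torus, are indexed by
   beta in (A_theta^* )^-1 Z^d once a point s zeta of each fiber is chosen. *)
Definition bracket_series (p q : L0) (s : Td -> Rd) (u : Zd -> Linf) : Prop :=
  forall k, \forall zeta \ae haar R d,
    u k zeta = bracket_term p q (s zeta + invmx A_theta^T *m Zd_incl k).

End bracket.

(* Main.v *)
(* The matrix A of theta is nonsingular: by simultaneous approximation a null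
   vector of A would yield nonzero integer points k with theta k arbitrarily
   small, against discreteness of the image. Hence each fiber of theta_hat is a
   coset of the lattice (A^T)^-1 Z^d, and a property holds almost everywhere on
   R^d iff it holds, for almost every zeta, at all points of the fiber of zeta;
   this only needs that translations and linear automorphisms preserve null
   sets. On almost every fiber an element of Y_theta is thus a square-summable
   family with a uniform bound, so that the bracket converges absolutely and the
   module axioms hold fiberwise. For completeness, |p(xi)|^2 is at most
   |det A| ||p||^2 almost everywhere, so a Cauchy sequence converges pointwise
   almost everywhere, and Fatou's argument on finite parts of the fibers turns
   this into convergence in norm. Weak* convergence is the exchange of sum and
   integral for a series dominated by a multiple of |g|. *)

Require Import Defs.
From mathcomp Require Import all_boot all_order all_algebra finmap.
From mathcomp Require Import complex lra ring.
From mathcomp Require Import all_classical all_reals all_analysis.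
From mathcomp Require Import measurable_realfun ess_sup_inf.

Set Implicit Arguments.
Unset Strict Implicit.
Unset Printing Implicit Defensive.

Import Order.TTheory GRing.Theory Num.Theory.
Import numFieldNormedType.Exports.
Import ComplexField Normc.

Local Open Scope classical_set_scope.
Local Open Scope complex_scope.
Local Open Scope ring_scope.

(** * Unconditional sums *)

Section complex_lemmas.
Variable R : realType.
Implicit Types z w : R[i].

Lemma normc_real (r : R) : normc r%:C = `|r|.
Proof. by rewrite /normc /= expr0n addr0 sqrtr_sqr. Qed.

Lemma le_normcB z w : normc (z - w) <= normc z + normc w.
Proof. by rewrite -(normcN w) le_normcD. Qed.

Lemma normc_sqr z : normc z ^+ 2 = complex.Re z ^+ 2 + complex.Im z ^+ 2.
Proof. by case: z => a b; rewrite sqr_sqrtr// addr_ge0// sqr_ge0. Qed.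

Lemma conjc_mul_self z : z^* * z = (normc z ^+ 2)%:C.
Proof.
rewrite normc_sqr; case: z => a b; simpc.
by apply/eqP; rewrite eq_complex /=; apply/andP; split; apply/eqP; ring.
Qed.

End complex_lemmas.

Section has_sum_theory.
Variables (R : realType) (I : choiceType).
Implicit Types (D : set I) (f g : I -> R[i]) (s t : R[i]).

(** Finite subsets of [D] are directed by union, so one finite set serves both limits. *)
Lemma fset_cvg_unique D (S : {fset I} -> R[i]) s t :
  fset_cvg D S s -> fset_cvg D S t -> s = t.
Proof.
move=> hs ht; apply/eqP; rewrite -subr_eq0; apply/eqP/eq0_normc.
apply/eqP; rewrite eq_le normc_ge0 andbT; apply/ler_addgt0Pl => e e0.
have e2 : 0 < e / 2 by rewrite divr_gt0.
have [F FD hF] := hs _ e2; have [G GD hG] := ht _ e2.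
have FGD : [set` (F `|` G)%fset] `<=` D.
  by move=> i /=; rewrite inE => /orP[/FD|/GD].
have := hF _ (fsubsetUl F G) FGD; have := hG _ (fsubsetUr F G) FGD.
set u := S _ => h1 h2.
rewrite (_ : s - t = (u - t) - (u - s)); last by ring.
rewrite addr0 (le_trans (le_normcB _ _))//; lra.
Qed.

Lemma has_sum_unique D f s t : has_sum D f s -> has_sum D f t -> s = t.
Proof. exact: fset_cvg_unique. Qed.

Lemma eq_has_sum D f g s : (forall i, D i -> f i = g i) ->
  has_sum D f s -> has_sum D g s.
Proof.
move=> fg fs e /fs[F FD h]; exists F => // G FG GD.
rewrite (_ : \sum_(i <- G) g i = \sum_(i <- G) f i); first exact: h.
by apply: eq_big_seq => i iG; rewrite fg//; exact: GD.
Qed.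

Lemma has_sumD D f g s t : has_sum D f s -> has_sum D g t ->
  has_sum D (fun i => f i + g i) (s + t).
Proof.
move=> fs gt e e0; have e2 : 0 < e / 2 by rewrite divr_gt0.
have [F FD hF] := fs _ e2; have [G GD hG] := gt _ e2.
exists (F `|` G)%fset; first by move=> i /=; rewrite inE => /orP[/FD|/GD].
move=> H; rewrite fsubUset => /andP[FH GH] HD.
rewrite big_split/= opprD addrACA (le_lt_trans (le_normcD _ _))//.
by have := hF _ FH HD; have := hG _ GH HD; lra.
Qed.

Lemma has_sumZ D a f s : has_sum D f s -> has_sum D (fun i => a * f i) (a * s).
Proof.
move=> fs e e0; have [->|a0] := eqVneq a 0.
  exists fset0 => // F _ _; rewrite big1 ?mul0r ?subr0 ?normc0// => i _.
  by rewrite mul0r.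
have na0 : 0 < normc a.
  rewrite lt_neqAle normc_ge0 andbT eq_sym.
  by apply: contra_neq a0; exact: eq0_normc.
have [|F FD hF] := fs (e / normc a); first by rewrite divr_gt0.
exists F => // G FG GD; rewrite -mulr_sumr -mulrBr normcM.
by rewrite mulrC -ltr_pdivlMr//; exact: hF.
Qed.

Lemma has_sumJ D f s : has_sum D f s -> has_sum D (fun i => (f i)^*) s^*.
Proof.
move=> fs e /fs[F FD hF]; exists F => // G FG GD.
by rewrite -rmorph_sum -rmorphB Defs.normcJ; exact: hF.
Qed.

(** Partial sums of nonnegative terms increase with the finite set and have the [\esum] as supremum;
    a finite set within [e] of the supremum therefore controls all larger ones. *)
Lemma has_sum_nneg D (f : I -> R) : (forall i, D i -> 0 <= f i) ->
  (\esum_(i in D) (f i)%:E < +oo)%E ->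
  has_sum D (fun i => (f i)%:C) (fine (\esum_(i in D) (f i)%:E))%:C.
Proof.
move=> f0 foo e e0.
have fE0 i : D i -> (0 <= (f i)%:E)%E by move=> /f0; rewrite lee_fin.
set s := fine _.
have sE : \esum_(i in D) (f i)%:E = s%:E.
  by rewrite fineK// ge0_fin_numE// esum_ge0.
have : ((s - e)%:E < \esum_(i in D) (f i)%:E)%E by rewrite sE lte_fin; lra.
move=> /ereal_sup_gt[_ [X [finX XD] <-]].
rewrite fsbig_finite//= sumEFin lte_fin => hX.
exists (fset_set X); first by rewrite fset_setK.
move=> F XF FD.
have Fs : \sum_(i <- F) f i <= s.
  rewrite -lee_fin -sE; apply: ereal_sup_ubound; exists [set` F] => //.
  by rewrite fsbig_finite//= set_fsetK sumEFin.
have XFs : \sum_(i <- fset_set X) f i <= \sum_(i <- F) f i.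
  rewrite [leRHS](bigID (fun i => i \in fset_set X))/=.
  rewrite -[leLHS]addr0; apply: lerD; last first.
    rewrite big_seq_cond; apply: sumr_ge0 => i /andP[iF _].
    by apply: f0; exact: FD.
  have FX : perm_eq (fset_set X) [seq i <- F | i \in fset_set X].
    apply: uniq_perm => [||i]; [exact: fset_uniq|exact/filter_uniq/fset_uniq|].
    rewrite mem_filter; case iX : (i \in fset_set X) => //=.
    by rewrite (fsubsetP XF).
  by rewrite -[leRHS]big_filter (perm_big _ FX).
rewrite -(rmorph_sum (real_complex R)) -(rmorphB (real_complex R)) normc_real.
by rewrite ler0_norm; lra.
Qed.

(* The sum of an absolutely summable family, by a formula which makes it
   measurable in parameters. *)
Definition rsum D (g : I -> R) : R :=
  fine (\esum_(i in D) (g^\+ i)%:E) - fine (\esum_(i in D) (g^\- i)%:E).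

Definition csum D f : R[i] :=
  rsum D (fun i => complex.Re (f i)) +i* rsum D (fun i => complex.Im (f i)).

(** The positive and negative parts are dominated by the absolute value, so each has a finite sum
    and the two can be subtracted. *)
Lemma has_sum_rsum D (g : I -> R) : (\esum_(i in D) `|g i|%:E < +oo)%E ->
  has_sum D (fun i => (g i)%:C) (rsum D g)%:C.
Proof.
move=> goo.
have normgE i : `|g i| = g^\+ i + g^\- i.
  by rewrite -[LHS]/((Num.norm \o g) i) -funrposDneg.
have gE i : g i = g^\+ i - g^\- i by rewrite -[in LHS](funrposBneg g).
have pos : has_sum D (fun i => (g^\+ i)%:C)
    (fine (\esum_(i in D) (g^\+ i)%:E))%:C.
  apply: has_sum_nneg => [i _|]; first by rewrite funrpos_ge0.
  apply: le_lt_trans goo; apply: le_esum => i _.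
  by rewrite lee_fin normgE lerDl funrneg_ge0.
have neg : has_sum D (fun i => (g^\- i)%:C)
    (fine (\esum_(i in D) (g^\- i)%:E))%:C.
  apply: has_sum_nneg => [i _|]; first by rewrite funrneg_ge0.
  apply: le_lt_trans goo; apply: le_esum => i _.
  by rewrite lee_fin normgE lerDr funrpos_ge0.
have := has_sumD pos (has_sumZ (-1) neg).
rewrite mulN1r -(rmorphB (real_complex R)); apply: eq_has_sum => i _.
by rewrite mulN1r -(rmorphB (real_complex R)) -gE.
Qed.

Lemma has_sum_csum D f : (\esum_(i in D) (normc (f i))%:E < +oo)%E ->
  has_sum D f (csum D f).
Proof.
move=> foo.
have hr : (\esum_(i in D) `|complex.Re (f i)|%:E < +oo)%E.
  by apply: le_lt_trans foo; apply: le_esum => i _; rewrite lee_fin normr_Re.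
have hi : (\esum_(i in D) `|complex.Im (f i)|%:E < +oo)%E.
  by apply: le_lt_trans foo; apply: le_esum => i _; rewrite lee_fin normr_Im.
rewrite [csum D f]complexE.
have := has_sumD (has_sum_rsum hr) (has_sumZ 'i (has_sum_rsum hi)).
by apply: eq_has_sum => i _; rewrite -complexE.
Qed.

(** Some finite partial sum is within [e] of [s], and the triangle inequality bounds every finite
    partial sum by [M]. *)
Lemma has_sum_norm_le D f s (M : R) : has_sum D f s ->
  (\esum_(i in D) (normc (f i))%:E <= M%:E)%E -> normc s <= M.
Proof.
move=> fs fM; apply/ler_addgt0Pr => e /fs[F FD /(_ F (fsubset_refl F) FD) h].
rewrite -(subrK (\sum_(i <- F) f i) s) (le_trans (le_normcD _ _))// addrC lerD//.
  apply: (@le_trans _ _ (\sum_(i <- F) normc (f i))).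
    elim/big_rec2 : _ => [|i y x _ yx]; first by rewrite normc0.
    by rewrite (le_trans (le_normcD _ _))// lerD.
  rewrite -lee_fin; apply: le_trans fM; apply: ereal_sup_ubound.
  by exists [set` F] => //; rewrite fsbig_finite//= set_fsetK sumEFin.
by rewrite -normcN opprB ltW.
Qed.

End has_sum_theory.

Lemma measurable_sqrt d (T : measurableType d) (R : realType) (f : T -> R) :
  measurable_fun setT f -> measurable_fun setT (fun x => Num.sqrt (f x)).
Proof.
apply: measurableT_comp; apply: continuous_measurable_fun.
exact: sqrt_continuous.
Qed.

Lemma measurable_normc d (T : measurableType d) (R : realType) (f : T -> R[i]) :
  measurable_fun setT f -> measurable_fun setT (fun x => normc (f x)).
Proof.
move=> /measurable_funCP[mr mi].
rewrite (_ : (fun x => _) = (fun x =>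
  Num.sqrt (complex.Re (f x) ^+ 2 + complex.Im (f x) ^+ 2))).
  by apply/measurable_sqrt/measurable_funD; exact: measurable_funX.
by apply/funext => x; case: (f x).
Qed.

(** * Countable sums depending on a parameter *)

Section countable_esum.
Context d (T : measurableType d) (R : realType) (I : countType).

(** Enumerating [I] by its codes reduces the matter to series over the natural numbers, where
    measurability and exchange with the integral are known. [pickle_inv] yields a value only at
    actual codes, so no index is counted twice. *)
Lemma esum_countable (a : I -> \bar R) : (forall i, 0 <= a i)%E ->
  \esum_(i in setT) a i =
  (\sum_(n <oo) if @pickle_inv I n is Some i then a i else 0)%E.
Proof.
move=> a0; rewrite nneseries_esumT; last by move=> n; case: pickle_inv.
transitivity (\esum_(n in range (@choice.pickle I))
    if @pickle_inv I n is Some i then a i else 0%E).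
  rewrite esum_image; last by move=> i j _ _; exact: (pcan_inj (@choice.pickleK I)).
  by apply: eq_esum => i _; rewrite pickleK_inv.
rewrite [LHS]esum_mkcond; apply: eq_esum => n _.
case: ifPn => //; rewrite notin_setE => nI; case E : pickle_inv => [i|//].
by exfalso; apply: nI; exists i => //; have := @pickle_invK I n; rewrite E.
Qed.

Lemma measurable_esum_countable (f : I -> T -> \bar R) :
  (forall i, measurable_fun setT (f i)) -> (forall i x, 0 <= f i x)%E ->
  measurable_fun setT (fun x => \esum_(i in setT) f i x).
Proof.
move=> mf f0; under eq_fun do rewrite esum_countable//.
apply: ge0_emeasurable_sum => [n x _ _|n _]; first by case: pickle_inv.
by case: pickle_inv => //; exact: measurable_cst.
Qed.

Lemma integral_esum_countable (mu : {measure set T -> \bar R})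
    (f : I -> T -> \bar R) :
  (forall i, measurable_fun setT (f i)) -> (forall i x, 0 <= f i x)%E ->
  (\int[mu]_x \esum_(i in setT) f i x)%E =
  \esum_(i in setT) (\int[mu]_x f i x)%E.
Proof.
move=> mf f0; rewrite esum_countable; last by move=> i; exact: integral_ge0.
under eq_integral do rewrite esum_countable//.
rewrite integral_nneseries//.
- apply: eq_eseriesr => n _; case: pickle_inv => //.
  exact: integral0.
- by move=> n; case: pickle_inv => //; exact: measurable_cst.
- by move=> n x _; case: pickle_inv.
Qed.

(** [fine] is itself measurable, so points where the sums diverge require no case distinction. *)
Lemma measurable_rsum_countable (g : I -> T -> R) :
  (forall i, measurable_fun setT (g i)) ->
  measurable_fun setT (fun x => rsum setT (g^~ x)).
Proof.
move=> mg; apply: measurable_funB.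
  apply: (measurableT_comp (fine_measurable measurableT)).
  apply: measurable_esum_countable => [i|i x].
    exact/measurable_EFinP/measurable_funrpos.
  by rewrite lee_fin; exact: funrpos_ge0.
apply: (measurableT_comp (fine_measurable measurableT)).
apply: measurable_esum_countable => [i|i x].
  exact/measurable_EFinP/measurable_funrneg.
by rewrite lee_fin; exact: funrneg_ge0.
Qed.

Lemma measurable_csum_countable (f : I -> T -> R[i]) :
  (forall i, measurable_fun setT (f i)) ->
  measurable_fun setT (fun x => csum setT (f^~ x)).
Proof.
move=> mf; apply/measurable_funCP; split; apply: measurable_rsum_countable => i.
  by have /measurable_funCP[] := mf i.
by have /measurable_funCP[] := mf i.
Qed.

End countable_esum.

(** * Lebesgue null sets *)

Section null_sets.
Context d1 d2 (T1 : measurableType d1) (T2 : measurableType d2) (R : realType).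

Lemma ae_comp (mu : {measure set T1 -> \bar R}) (nu : {measure set T2 -> \bar R})
    (f : T1 -> T2) (P : T2 -> Prop) :
  measurable_fun setT f ->
  (forall A, measurable A -> nu A = 0%E -> mu (f @^-1` A) = 0%E) ->
  (\forall y \ae nu, P y) -> \forall x \ae mu, P (f x).
Proof.
move=> mf null [A [mA A0 PA]]; exists (f @^-1` A); split; last first.
- by move=> x /= Pfx; exact: PA.
- exact: null.
- by rewrite -[X in measurable X]setTI; exact: mf.
Qed.

Lemma integral_eq0_ae (mu : {measure set T1 -> \bar R}) (f : T1 -> \bar R) :
  measurable_fun setT f -> (forall x, 0 <= f x)%E ->
  (\int[mu]_x f x)%E = 0%E <-> \forall x \ae mu, f x = 0%E.
Proof.
move=> mf f0; have := ae_eq_integral_abs mu measurableT mf.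
under eq_integral do rewrite gee0_abs//.
by move=> ->; split; apply: filterS => x // /(_ I).
Qed.

(** The product measure is the integral of the measures of the sections; this is what makes
    induction on the dimension possible for null sets. *)
Lemma product_measure1_eq0 (m1 : {measure set T1 -> \bar R})
    (m2 : {sigma_finite_measure set T2 -> \bar R}) A : measurable A ->
  (m1 \x m2)%E A = 0%E <-> \forall x \ae m1, m2 (xsection A x) = 0%E.
Proof.
move=> mA; rewrite /product_measure1 integral_eq0_ae//=.
exact: measurable_fun_xsection.
Qed.

End null_sets.

Section lebesgue_null_sets.
Variable R : realType.

(** By uniqueness of Lebesgue measure it suffices to compare on half-open intervals, whose length is
    unchanged by translation. *)
Lemma lebesgue_measure_shift (a : R) (A : set R) : measurable A ->
  lebesgue_measure ((fun x : R => x + a) @^-1` A) = lebesgue_measure A.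
Proof.
move=> mA.
have ms : measurable_fun setT
    (fun x : measurableTypeR R => (x + a : measurableTypeR R)).
  exact: measurable_funD.
rewrite -[LHS]/(pushforward lebesgue_measure
  (fun x : measurableTypeR R => (x + a : measurableTypeR R)) A).
apply/esym; apply: lebesgue_measure_unique => //= _ [[u v]] _ <-.
rewrite /pushforward (_ : _ @^-1` _ = `]u - a, v - a]%classic); last first.
  by apply/seteqP; split=> x /=; rewrite !in_itv/= ltrBlDr lerBrDr.
rewrite !lebesgue_measure_itv/= !lte_fin ltrD2r.
by case: ifP => // _; rewrite -!EFinB; congr (_%:E); lra.
Qed.

(** Induction on the dimension: the section at [x] of the translated set is a translate, by the tail
    of [v], of the section of [A] at [x + v ord0 0]. *)
Lemma lebesgue_cV_eq0_shift d (v : 'cV[R]_d) (A : set 'cV[R]_d) :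
  measurable A -> lebesgue_cV R d A = 0%E ->
  lebesgue_cV R d ((fun x => x + v) @^-1` A) = 0%E.
Proof.
elim: d v A => [|d IH] v A mA A0.
  (* In dimension 0 there is a single point, so the translation is the identity. *)
  rewrite (_ : _ @^-1` _ = A)//; apply/seteqP.
  by split=> x /=; rewrite [x + v](_ : _ = x)//; apply/colP => -[].
have mvec (w : 'cV[R]_d.+1) : measurable_fun setT (fun x : 'cV[R]_d.+1 => x + w).
  apply/measurable_fun_cVP => i.
  rewrite (_ : (fun _ => _) = (fun x : 'cV[R]_d.+1 => x i 0 + w i 0)).
    by apply: measurable_funD => //; exact: measurable_coord.
  by apply/funext => x; rewrite mxE.
have mC B : measurable B -> measurable (@cV_cons R d @^-1` B).
  by move=> mB; rewrite -[X in measurable X]setTI; exact: measurable_cV_cons.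
have mvA : measurable ((fun x => x + v) @^-1` A).
  by rewrite -[X in measurable X]setTI; exact: mvec.
move: A0; rewrite /= /lebesgue_cVS /pushforward.
move=> /(product_measure1_eq0 lebesgue_measure (lebesgue_cV R d) (mC _ mA)) A0.
apply/(product_measure1_eq0 lebesgue_measure (lebesgue_cV R d) (mC _ mvA)).
(* The first coordinates with a non-null section form a null set of reals, and still do after a
   shift. *)
have {}A0 := @ae_comp _ _ (measurableTypeR R) (measurableTypeR R) R
  lebesgue_measure lebesgue_measure (fun x : R => x + v ord0 0)
  (fun x => lebesgue_cV R d (xsection (@cV_cons R d @^-1` A) x) = 0%E)
  (measurable_funD (@measurable_id _ _ _) (@measurable_cst _ _ _ _ _ _)) _ A0.
apply: filterS (A0 _) => [|B mB B0]; last first.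
  by rewrite -B0; exact: lebesgue_measure_shift.
move=> x /(IH (\col_j v (lift ord0 j) 0) _ (measurable_xsection _ (mC _ mA))).
apply: etrans; congr (lebesgue_cV R d _); apply/funext => y.
rewrite /preimage /xsection /= !inE /=; congr (A _); apply/colP => i.
by rewrite !mxE; case: unliftP => [j ->|->] /=; rewrite ?mxE.
Qed.

Lemma measurable_mulmx m n (B : 'M[R]_(m, n)) :
  measurable_fun setT (fun x : 'cV[R]_n => B *m x).
Proof.
apply/measurable_fun_cVP => i.
rewrite (_ : (fun _ => _) = (fun x : 'cV[R]_n => \sum_(j < n) B i j * x j 0)).
  apply: measurable_sum => j; apply: measurable_funM => //.
  exact: measurable_coord.
by apply/funext => x; rewrite mxE.
Qed.

Lemma measurable_addcV d (T : measurableType d) n (f g : T -> 'cV[R]_n) :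
  measurable_fun setT f -> measurable_fun setT g ->
  measurable_fun setT (fun x => f x + g x).
Proof.
move=> /measurable_fun_cVP mf /measurable_fun_cVP mg.
apply/measurable_fun_cVP => i.
rewrite (_ : (fun _ => _) = (fun x => f x i 0 + g x i 0)).
  exact: measurable_funD.
by apply/funext => x; rewrite mxE.
Qed.

Lemma lebesgue_cV_gt0 d : (0 < lebesgue_cV R d setT)%E.
Proof.
apply: (@lt_le_trans _ _ (lebesgue_cV R d (@unit_cube R d))).
  by rewrite lebesgue_cV_unit_cube.
by apply: le_measure; rewrite ?inE//; exact: measurable_unit_cube.
Qed.

(* The sections of {(x, y) | x + By \in A} in x are translates of A, those in y
   are translates of the preimage of A under B. *)
Lemma lebesgue_cV_eq0_linear d (B : 'M[R]_d) (A : set 'cV[R]_d) :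
  B \in unitmx -> measurable A -> lebesgue_cV R d A = 0%E ->
  lebesgue_cV R d ((fun x => B *m x) @^-1` A) = 0%E.
Proof.
move=> uB mA A0; pose S := [set p : 'cV[R]_d * 'cV[R]_d | A (p.1 + B *m p.2)].
have mS : measurable S.
  rewrite (_ : S = setT `&` (fun p => p.1 + B *m p.2) @^-1` A); last first.
    by rewrite setTI.
  apply: measurable_addcV => //.
  exact: (measurableT_comp (measurable_mulmx B)).
(* By Tonelli the integrals of both kinds of sections of [S] agree; the one over [y] vanishes, its
   sections being translates of the null set [A]. *)
have := @indic_fubini_tonelli _ _ _ _ _ (lebesgue_cV R d) (lebesgue_cV R d) _ mS.
rewrite indic_fubini_tonelli_FE// indic_fubini_tonelli_GE//=.
rewrite [RHS]integral0_eq; last first.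
  move=> y _; rewrite (_ : ysection S y = (fun x => x + B *m y) @^-1` A).
    exact: lebesgue_cV_eq0_shift.
  by apply/seteqP; split=> x /=; rewrite /ysection /= inE.
have mx : measurable_fun setT (fun x => lebesgue_cV R d (xsection S x)).
  exact: measurable_fun_xsection.
move=> /(integral_eq0_ae _ mx (fun x => measure_ge0 _ _)).
(* The whole space has positive measure, so at least one [x] has a null section. *)
have mup := @ae_properfilter_algebraOfSetsType _ _ _ (lebesgue_cV R d)
  (lebesgue_cV_gt0 d).
move=> /(@filter_ex _ _ mup)[x].
(* This shift in [y] turns [x + B *m y] into [B *m y]. *)
move=> /(lebesgue_cV_eq0_shift (- (invmx B *m x)) (measurable_xsection _ mS)).
apply: etrans; congr (lebesgue_cV R d _); apply/funext => y.
rewrite /preimage /xsection /= inE /S /=; congr (A _).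
by rewrite mulmxDr mulmxN mulKVmx// addrC subrK.
Qed.

End lebesgue_null_sets.

(** * Nonsingularity *)

Section nonsingular.
Variables (R : realType) (d : nat).

(* Dirichlet's simultaneous approximation, by the pigeonhole principle on the
   fractional parts of the first multiples of v. *)
Lemma simultaneous_approximation (v : 'cV[R]_d) (N : nat) :
  exists n (k : 'cV[int]_d), (0 < n)%N /\
    forall i, `|n%:R * v i 0 - (k i 0)%:~R| < N.+1%:R^-1.
Proof.
pose fr (n : nat) i : R := n%:R * v i 0 - (Num.floor (n%:R * v i 0))%:~R.
have fr_itv n i : 0 <= fr n i < 1.
  have /andP[h1 h2] := floor_itv (n%:R * v i 0).
  rewrite /fr subr_ge0 h1 /=; move: h2; rewrite intrD; lra.
have N0 : 0 < N.+1%:R :> R by rewrite ltr0n.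
have tr_itv n i : (Num.truncn (N.+1%:R * fr n i))%:R <= N.+1%:R * fr n i <
    (Num.truncn (N.+1%:R * fr n i)).+1%:R.
  have /andP[h1 h2] := fr_itv n i.
  by apply: truncn_itv; rewrite mulr_ge0// ltW.
(* One more multiple of [v] than there are boxes; a box prescribes for each coordinate of the
   fractional part one of [N.+1] intervals of equal length. *)
pose f (n : 'I_(#|{ffun 'I_d -> 'I_N.+1}|.+1)) : {ffun 'I_d -> 'I_N.+1} :=
  [ffun i => inord (Num.truncn (N.+1%:R * fr n i))].
have /injectivePn[a [b ab fab]] : ~~ injectiveb f.
  apply/negP => /injectiveP /leq_card.
  by rewrite card_ord ltnn.
wlog ltab : a b ab fab / (a < b)%N.
  move=> wl; have := ab; rewrite -val_eqE neq_ltn => /orP[|] lt.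
    exact: wl lt.
  by apply: (wl b a) lt; rewrite // eq_sym.
exists (b - a)%N.
exists (\col_i (Num.floor (b%:R * v i 0) - Num.floor (a%:R * v i 0))).
rewrite subn_gt0; split=> // i; rewrite mxE natrB; last exact: ltnW.
rewrite intrB mulrBl.
have -> : b%:R * v i 0 - a%:R * v i 0 - ((Num.floor (b%:R * v i 0))%:~R -
    (Num.floor (a%:R * v i 0))%:~R) = fr b i - fr a i by rewrite /fr; lra.
have := congr1 (fun g : {ffun 'I_d -> 'I_N.+1} => val (g i)) fab.
(* The truncation stays below [N.+1], so [inord] does not alter it and equal boxes mean equal
   truncations. *)
have small n : (Num.truncn (N.+1%:R * fr n i) < N.+1)%N.
  have /andP[h1 h2] := fr_itv n i.
  rewrite -(ltr_nat R); have /andP[+ _] := tr_itv n i.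
  by move=> /le_lt_trans; apply; rewrite gtr_pMr.
rewrite !ffunE /= !inordK// => tE.
have := tr_itv a i; have := tr_itv b i; rewrite -tE.
set t := Num.truncn _; rewrite -[t.+1%:R]natr1 => /andP[h1 h2] /andP[h3 h4].
rewrite -(ltr_pM2l N0) mulfV ?gt_eqF//.
rewrite -[X in X * _]gtr0_norm// -normrM ltr_norml mulrBr; lra.
Qed.

Lemma det_A_theta_neq0 (theta : {additive 'cV[int]_d -> 'cV[R]_d}) :
  Zd_embedding theta -> \det (A_theta theta) != 0.
Proof.
move=> [inj _ op]; apply/negP; rewrite -det_tr => /det0P[u u0 uA].
have {u0}[j uj] : exists j, u 0 j != 0.
  apply/existsP; apply: contraNT u0; rewrite negb_exists => /forallP h.
  by apply/eqP/rowP => j; rewrite mxE; apply/eqP; have := h j; rewrite negbK.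
(* Normalising coordinate [j] to 1 makes the integer approximation of a positive multiple [n] of [v]
   nonzero there, since it differs from [n] by less than 1. *)
pose v := (u 0 j)^-1 *: u^T.
have Av : A_theta theta *m v = 0.
  by rewrite -scalemxAr -[A_theta _]trmxK -trmx_mul uA trmx0 scaler0.
have vj : v j 0 = 1 by rewrite !mxE mulVf.
(* The singleton of 0 is open in the discrete group, so some open [U] meets the image of [theta]
   only in 0. *)
have [|U oU UE] := op [set 0].
  exact: discrete_open.
have U0 : U 0.
  have : (U `&` range theta) 0 by rewrite -UE; exists 0; rewrite // raddf0.
  by case.
have [e /= e0 eU] : exists2 e, 0 < e & ball (0 : 'cV[R]_d) e `<=` U.
  by apply/nbhs_ballP; exact: open_nbhs_nbhs.
(* [C] dominates every row sum of absolute values, hence the operator norm for the maximum norm; [N]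
   then makes [C / N.+1] smaller than the radius [e]. *)
pose C : R := \sum_i \sum_j `|A_theta theta i j|.
have C0 : 0 <= C by do 2 (apply: sumr_ge0 => ? _).
pose N := Num.truncn (C / e).
have CN : C * N.+1%:R^-1 < e.
  rewrite ltr_pdivrMr ?ltr0n// mulrC -ltr_pdivrMr//.
  by have /andP[_] := truncn_itv (divr_ge0 C0 (ltW e0)).
have [n [k [n0 nk]]] := simultaneous_approximation v N.
have kj : k j 0 != 0.
  apply/eqP => kj0; have := nk j; rewrite vj kj0 mulr1 subr0 normr_nat.
  rewrite ltNge => /negP; apply; apply: (@le_trans _ _ 1).
    by rewrite invf_le1 ?ltr0n// ler1n.
  by rewrite ler1n.
(* As [A_theta] kills [v], [theta k] is the image of the small error vector [k - n v]. *)
have thk : theta k = A_theta theta *m (Zd_incl R k - n%:R *: v).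
  by rewrite thetaE mulmxBr -scalemxAr Av scaler0 subr0.
have : (U `&` range theta) (theta k).
  split; last by exists k.
  apply: eU; split=> // i l; rewrite (ord1 l) /ball /= mxE sub0r normrN.
  apply: le_lt_trans CN; rewrite thk mxE (le_trans (ler_norm_sum _ _ _))//.
  have AC : \sum_j `|A_theta theta i j| <= C.
    by rewrite /C [leRHS](bigD1 i)//= lerDl sumr_ge0// => ? _; rewrite sumr_ge0.
  apply: le_trans (ler_wpM2r _ AC); last by rewrite invr_ge0 ler0n.
  rewrite mulr_suml.
  apply: ler_sum => m _; rewrite normrM ler_wpM2l// !mxE distrC ltW//.
  by have := nk m; rewrite !mxE.
rewrite -UE => -[_ /= ->] /inj k0.
by move: kj; rewrite -k0 mxE eqxx.
Qed.

End nonsingular.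

(** * Fibers *)

Section countable_ae.
Context d (T : measurableType d) (R : realType) (I : countType).
Variable mu : {measure set T -> \bar R}.

Lemma negligible_bigcup_countable (F : I -> set T) :
  (forall i, mu.-negligible (F i)) -> mu.-negligible (\bigcup_i F i).
Proof.
move=> F0; pose G n := if @choice.unpickle I n is Some i then F i else set0.
apply: (@negligibleS _ _ _ _ (\bigcup_n G n)).
  by move=> x [i _ Fix]; exists (choice.pickle i); rewrite // /G choice.pickleK.
apply: negligible_bigcup => n; rewrite /G.
by case: choice.unpickle => //; exact: negligible_set0.
Qed.

Lemma ae_forall_countable (P : I -> T -> Prop) :
  (forall i, \forall x \ae mu, P i x) -> \forall x \ae mu, forall i, P i x.
Proof.
move=> h; apply: negligibleS (negligible_bigcup_countable h) => x.
by move=> /= /existsNP[i Pix]; exists i.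
Qed.

Lemma bigcup_measurable_countable (F : I -> set T) :
  (forall i, measurable (F i)) -> measurable (\bigcup_i F i).
Proof.
move=> mF; pose G n := if @choice.unpickle I n is Some i then F i else set0.
rewrite (_ : \bigcup_i F i = \bigcup_n G n).
  by apply: bigcupT_measurable => n; rewrite /G; case: choice.unpickle.
apply/seteqP; split=> x [].
  by move=> i _ Fix; exists (choice.pickle i); rewrite // /G choice.pickleK.
by move=> n _; rewrite /G; case: choice.unpickle => // i Fix; exists i.
Qed.

End countable_ae.

(** * Null sets of the torus and of its covering space *)

Section torus_null_sets.
Variables (R : realType) (d : nat).
Local Notation Rd := 'cV[R]_d.
Local Notation leb := (lebesgue_cV R d).

Definition frac_cV (x : Rd) : Rd := \col_i (x i 0 - (Num.floor (x i 0))%:~R).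

Definition floor_cV (x : Rd) : 'cV[int]_d := \col_i Num.floor (x i 0).

Lemma frac_cVE x : frac_cV x = x - Zd_incl R (floor_cV x).
Proof. by apply/colP => i; rewrite !mxE. Qed.

Lemma frac_cV_shift x (k : 'cV[int]_d) : frac_cV (x + Zd_incl R k) = frac_cV x.
Proof.
apply/colP => i; rewrite !mxE floorDrz ?intr_int// intrKfloor intrD.
by rewrite opprD addrACA subrr addr0.
Qed.

Lemma unit_cube_frac x : unit_cube (frac_cV x).
Proof.
move=> i; rewrite mxE.
have /andP[h1 h2] := floor_itv (x i 0).
by rewrite subr_ge0 h1 /=; move: h2; rewrite intrD; lra.
Qed.

Lemma measurable_frac_cV : measurable_fun setT frac_cV.
Proof.
apply/measurable_fun_cVP => i.
rewrite (_ : (fun _ => _) = (fun x : Rd => x i 0 - (Num.floor (x i 0))%:~R)).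
  apply: measurable_funB; first exact: measurable_coord.
  have mfl : measurable_fun setT (fun r : R => (Num.floor r)%:~R : R).
    apply: nondecreasing_measurable => // r s rs.
    by rewrite ler_int le_floor.
  exact: (measurableT_comp mfl (measurable_coord i)).
by apply/funext => x; rewrite mxE.
Qed.

Lemma to_torusD (x : Rd) (k : 'cV[int]_d) :
  to_torus (x + Zd_incl R k) = to_torus x.
Proof.
apply/to_torusP => i; rewrite !mxE addrAC subrr add0r; exact: intr_int.
Qed.

Lemma to_torus_eqP (x y : Rd) :
  to_torus x = to_torus y <-> exists k, y = x + Zd_incl R k.
Proof.
split=> [/to_torusP xy|[k ->]]; last by rewrite to_torusD.
exists (\col_i - Num.floor (x i 0 - y i 0)).
apply/colP => i; rewrite !mxE intrN.
by have := xy i; rewrite intrEfloor => /eqP ->; rewrite subKr.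
Qed.

Lemma measurable_shift (v : Rd) : measurable_fun setT (fun x : Rd => x + v).
Proof. exact: measurable_addcV. Qed.

(** The preimage of a subset of the torus is covered by the integer translates of its part in the
    unit cube. *)
Lemma ae_to_torus (P : torus R d -> Prop) :
  (\forall z \ae haar R d, P z) -> \forall x \ae leb, P (to_torus x).
Proof.
apply: ae_comp; first exact: measurable_to_torus.
move=> A mA; set B := @to_torus R d @^-1` A `&` @unit_cube R d.
(* [haar A] is by definition the Lebesgue measure of [B]. *)
move=> B0; have {}B0 : leb B = 0%E := B0.
have mB : measurable B by apply: measurableI => //; exact: measurable_unit_cube.
apply: measure_negligible; first exact: mA.
apply: negligibleS (@negligible_bigcup_countable _ _ _ 'cV[int]_d leb
  (fun k => (fun x => x + Zd_incl R k) @^-1` B) _).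
  move=> x Ax; exists (- floor_cV x) => //=.
  rewrite [Zd_incl _ _]raddfN -frac_cVE; split; last exact: unit_cube_frac.
  by rewrite /preimage /= frac_cVE -raddfN to_torusD.
move=> k; apply/negligibleP; last exact: lebesgue_cV_eq0_shift.
by rewrite -[X in measurable X]setTI; exact: measurable_shift.
Qed.

(** The classes that meet a null set [A] form a null set: their preimage is the union of the integer
    translates of [A], which is measurable and null by countability. *)
Lemma ae_of_torus (P : Rd -> Prop) :
  (\forall x \ae leb, P x) ->
  \forall z \ae haar R d, forall x, to_torus x = z -> P x.
Proof.
move=> [A [mA A0 PA]].
have tA : @to_torus R d @^-1` (@to_torus R d @` A) =
    \bigcup_k (fun x => x + Zd_incl R k) @^-1` A.
  apply/seteqP; split=> x /=.
    by move=> [y Ay] /esym/to_torus_eqP[k yE]; exists k; rewrite //= -yE.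
  by move=> [k _ /=]; exists (x + Zd_incl R k); rewrite ?to_torusD.
have mshift k : measurable ((fun x => x + Zd_incl R k) @^-1` A).
  by rewrite -[X in measurable X]setTI; exact: measurable_shift.
have mt : measurable (@to_torus R d @^-1` (@to_torus R d @` A)).
  by rewrite tA; exact: bigcup_measurable_countable.
exists (@to_torus R d @` A); split; first exact: mt; last first.
  move=> z /= /existsNP[x /not_implyP[xz Px]]; exists x => //.
  exact: PA.
apply: (@measure_negligible _ _ _ leb).
  by apply: measurableI => //; exact: measurable_unit_cube.
apply: negligibleS (@subIsetl _ _ _) _; rewrite tA.
apply: negligible_bigcup_countable => k; apply/negligibleP => //.
exact: lebesgue_cV_eq0_shift.
Qed.

End torus_null_sets.

Section fibers.
Variables (R : realType) (d : nat) (theta : {additive 'cV[int]_d -> 'cV[R]_d}).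
Hypothesis detA : \det (A_theta theta) != 0.
Local Notation Rd := 'cV[R]_d.
Local Notation leb := (lebesgue_cV R d).
Local Notation At := (A_theta theta)^T.

Lemma At_unit : At \in unitmx.
Proof. by rewrite unitmxE det_tr unitfE. Qed.

Lemma ae_theta_hat (P : torus R d -> Prop) :
  (\forall z \ae haar R d, P z) -> \forall xi \ae leb, P (theta_hat theta xi).
Proof.
move=> /ae_to_torus; apply: ae_comp; first exact: measurable_mulmx.
by move=> A; apply: lebesgue_cV_eq0_linear; exact: At_unit.
Qed.

Lemma ae_fiber (P : Rd -> Prop) : (\forall xi \ae leb, P xi) ->
  \forall z \ae haar R d, forall xi, fiber theta z xi -> P xi.
Proof.
move=> aeP.
have : \forall x \ae leb, P (invmx At *m x).
  move: aeP; apply: ae_comp; first exact: measurable_mulmx.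
  by move=> A; apply: lebesgue_cV_eq0_linear; rewrite unitmx_inv At_unit.
move=> /ae_of_torus; apply: filterS => z h xi /h.
by rewrite mulKmx// At_unit.
Qed.

(** Parametrizes the coset of the lattice [(A^T)^-1 Z^d] through [xi], in the form in which points
    occur in [bracket_series]. *)
Definition fiber_point (xi : Rd) (k : 'cV[int]_d) : Rd :=
  xi + invmx At *m Zd_incl R k.

Lemma fiber_pointP (xi eta : Rd) :
  theta_hat theta eta = theta_hat theta xi <-> exists k, eta = fiber_point xi k.
Proof.
rewrite /theta_hat /fiber_point; split.
  move=> /esym/to_torus_eqP[k e]; exists k.
  by rewrite -[eta](mulKmx At_unit) e mulmxDr mulKmx// At_unit.
by move=> [k ->]; rewrite mulmxDr mulKVmx ?At_unit// to_torusD.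
Qed.

Lemma fiber_point_inj xi : injective (fiber_point xi).
Proof.
move=> k l /addrI /(congr1 (mulmx At)); rewrite !mulKVmx ?At_unit//.
by move=> /colP h; apply/colP => i; have := h i; rewrite !mxE => /intr_inj.
Qed.

Lemma fiberE xi : fiber theta (theta_hat theta xi) = range (fiber_point xi).
Proof.
apply/seteqP; split=> eta /=.
  by move=> /fiber_pointP[k ->]; exists k.
by move=> [k _ <-]; apply/fiber_pointP; exists k.
Qed.

Lemma theta_section_exists : exists s, theta_section theta s.
Proof.
(* The choice [repr] need not be measurable, but its fractional part depends only on the class:
   composed with [to_torus] it is [frac_cV], which is measurable. *)
exists (fun z => invmx At *m frac_cV (repr z)); split; last first.
  move=> z; rewrite /theta_hat mulKVmx ?At_unit// frac_cVE.
  by rewrite -raddfN to_torusD; exact: reprK.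
apply: measurableT_comp; first exact: measurable_mulmx.
move=> _ B mB; rewrite setTI.
rewrite /measurable /= /torus_measurable /=.
rewrite (_ : _ @^-1` _ = (@frac_cV R d) @^-1` B).
  by rewrite -[X in measurable X]setTI; exact: measurable_frac_cV.
apply/funext => x; rewrite /preimage /=; congr (B _).
have /to_torus_eqP[k ->] : to_torus x = to_torus (repr (to_torus x)).
  exact/esym/reprK.
by rewrite frac_cV_shift.
Qed.

End fibers.

(** * Sums and integrals *)

Section integral_sums.
Context d (T : measurableType d) (R : realType) (I : countType).
Variable mu : probability T R.

Lemma integrable_nneg (h : T -> R) : measurable_fun setT h ->
  (forall x, 0 <= h x) -> (\int[mu]_x (h x)%:E < +oo)%E ->
  mu.-integrable setT (EFin \o h).
Proof.
move=> mh h0 hoo; apply/integrableP; split; first exact/measurable_EFinP.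
by under eq_integral do rewrite gee0_abs ?lee_fin//.
Qed.

Section nneg.
Variable h : I -> T -> R.
Hypotheses (mh : forall k, measurable_fun setT (h k))
  (h0 : forall k x, 0 <= h k x)
  (hoo : (\int[mu]_x (\esum_(k in setT) (h k x)%:E) < +oo)%E).

Let mhE k : measurable_fun setT (fun x => (h k x)%:E).
Proof. exact/measurable_EFinP. Qed.

Let hE0 k x : (0 <= (h k x)%:E)%E.
Proof. by rewrite lee_fin. Qed.

Let mS : measurable_fun setT (fun x => \esum_(k in setT) (h k x)%:E).
Proof. exact: measurable_esum_countable. Qed.

Let S_ge0 x : (0 <= \esum_(k in setT) (h k x)%:E)%E.
Proof. exact: esum_ge0. Qed.

Lemma integrable_esum :
  mu.-integrable setT (fun x => \esum_(k in setT) (h k x)%:E).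
Proof.
apply/integrableP; split=> //.
by under eq_integral do rewrite gee0_abs//.
Qed.

(** An integrable sum is infinite only on a null set, where [fine] replaces it by 0. *)
Let fineS : \forall x \ae mu, (fine (\esum_(k in setT) (h k x)%:E))%:E =
  \esum_(k in setT) (h k x)%:E.
Proof.
have := integrable_ae measurableT integrable_esum.
by apply: filterS => x /(_ Logic.I) /fineK.
Qed.

Let int_fineS : (\int[mu]_x (fine (\esum_(k in setT) (h k x)%:E))%:E =
  \int[mu]_x \esum_(k in setT) (h k x)%:E)%E.
Proof.
apply: ge0_ae_eq_integral => //.
- exact/measurable_EFinP/(measurableT_comp (fine_measurable measurableT)).
- by move=> x _; rewrite lee_fin fine_ge0.
- by apply: filterS fineS => x ->.
Qed.

Lemma integrable_fine_esum :
  mu.-integrable setT (EFin \o (fun x => fine (\esum_(k in setT) (h k x)%:E))).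
Proof.
apply: integrable_nneg => [|x|]; last by rewrite int_fineS.
- exact: (measurableT_comp (fine_measurable measurableT)).
- by rewrite fine_ge0.
Qed.

Lemma integrable_esum_term k : mu.-integrable setT (EFin \o h k).
Proof.
apply: integrable_nneg => //; apply: le_lt_trans hoo.
apply: ge0_le_integral => // x _; apply: esum_ge.
exists [set k]; first by split => //; exact: finite_set1.
by rewrite fsbig_set1.
Qed.

(** Monotone convergence exchanges the integral with the [\esum], and a finite sum of nonnegative
    numbers converges unconditionally. *)
Lemma has_sum_Rintegral_nneg :
  has_sum setT (fun k => (\int[mu]_x h k x)%:C)
    (\int[mu]_x fine (\esum_(k in setT) (h k x)%:E))%:C.
Proof.
have hk k : (\int[mu]_x h k x)%:E = (\int[mu]_x (h k x)%:E)%E.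
  by rewrite fineK//; apply: integrable_fin_num => //; exact: integrable_esum_term.
have sE : \esum_(k in setT) (\int[mu]_x h k x)%:E =
    (\int[mu]_x \esum_(k in setT) (h k x)%:E)%E.
  by rewrite integral_esum_countable//; apply: eq_esum => k _.
rewrite (_ : Rintegral _ _ _ = fine (\esum_(k in setT) (\int[mu]_x h k x)%:E)).
  apply: has_sum_nneg => [k _|]; first by apply: Rintegral_ge0.
  by rewrite sE.
by rewrite sE -int_fineS.
Qed.

End nneg.

Lemma has_sum_Rintegral (g : I -> T -> R) :
  (forall k, measurable_fun setT (g k)) ->
  (\int[mu]_x (\esum_(k in setT) `|g k x|%:E) < +oo)%E ->
  has_sum setT (fun k => (\int[mu]_x g k x)%:C)
    (\int[mu]_x rsum setT (g^~ x))%:C.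
Proof.
move=> mg goo.
have normgE k x : `|g k x| = (g k)^\+ x + (g k)^\- x.
  by rewrite -[LHS]/((Num.norm \o g k) x) -funrposDneg.
have mp k := measurable_funrpos (mg k).
have mn k := measurable_funrneg (mg k).
have mabs k : measurable_fun setT (fun x => `|g k x|%:E).
  exact/measurable_EFinP/measurableT_comp.
have poo : (\int[mu]_x (\esum_(k in setT) ((g k)^\+ x)%:E) < +oo)%E.
  apply: le_lt_trans goo; apply: ge0_le_integral => //.
  - by move=> x _; apply: esum_ge0 => k _; rewrite lee_fin funrpos_ge0.
  - apply: measurable_esum_countable => [k|k x]; first exact/measurable_EFinP.
    by rewrite lee_fin funrpos_ge0.
  - by apply: measurable_esum_countable => k.
  - move=> x _; apply: le_esum => k _.
    by rewrite lee_fin normgE lerDl funrneg_ge0.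
have noo : (\int[mu]_x (\esum_(k in setT) ((g k)^\- x)%:E) < +oo)%E.
  apply: le_lt_trans goo; apply: ge0_le_integral => //.
  - by move=> x _; apply: esum_ge0 => k _; rewrite lee_fin funrneg_ge0.
  - apply: measurable_esum_countable => [k|k x]; first exact/measurable_EFinP.
    by rewrite lee_fin funrneg_ge0.
  - by apply: measurable_esum_countable => k.
  - move=> x _; apply: le_esum => k _.
    by rewrite lee_fin normgE lerDr funrpos_ge0.
have p0 k x : 0 <= (g k)^\+ x by rewrite funrpos_ge0.
have n0 k x : 0 <= (g k)^\- x by rewrite funrneg_ge0.
have := has_sumD (has_sum_Rintegral_nneg mp p0 poo)
  (has_sumZ (-1) (has_sum_Rintegral_nneg mn n0 noo)).
rewrite mulN1r -(rmorphB (real_complex R)) -RintegralB//; last 2 first.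
- exact: integrable_fine_esum.
- exact: integrable_fine_esum.
apply: eq_has_sum => k _; rewrite mulN1r -(rmorphB (real_complex R)) -RintegralB//.
- by congr (_%:C); apply: eq_Rintegral => x _; rewrite -[in RHS](funrposBneg (g k)).
- exact: (integrable_esum_term mp p0 poo).
- exact: (integrable_esum_term mn n0 noo).
Qed.

Lemma has_sum_cintegral (f : I -> T -> R[i]) :
  (forall k, measurable_fun setT (f k)) ->
  (\int[mu]_x (\esum_(k in setT) (normc (f k x))%:E) < +oo)%E ->
  has_sum setT (fun k => cintegral mu (f k))
    (cintegral mu (fun x => csum setT (f^~ x))).
Proof.
move=> mf foo.
have mnorm k : measurable_fun setT (fun x => (normc (f k x))%:E).
  exact/measurable_EFinP/measurable_normc.
have mr k : measurable_fun setT (fun x => complex.Re (f k x)).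
  by have /measurable_funCP[] := mf k.
have mi k : measurable_fun setT (fun x => complex.Im (f k x)).
  by have /measurable_funCP[] := mf k.
have ms (g : I -> T -> R) : (forall k, measurable_fun setT (g k)) ->
    (forall k x, `|g k x| <= normc (f k x)) ->
    (\int[mu]_x (\esum_(k in setT) `|g k x|%:E) < +oo)%E.
  move=> mg gf; apply: le_lt_trans foo; apply: ge0_le_integral => //.
  - by move=> x _; apply: esum_ge0 => k _; rewrite lee_fin.
  - apply: measurable_esum_countable => [k|k x]; last by rewrite lee_fin.
    exact/measurable_EFinP/measurableT_comp.
  - by apply: measurable_esum_countable => // k x; rewrite lee_fin normc_ge0.
  - by move=> x _; apply: le_esum => k _; rewrite lee_fin.
have hr := has_sum_Rintegral mr (ms _ mr (fun k x => normr_Re (f k x))).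
have hi := has_sum_Rintegral mi (ms _ mi (fun k x => normr_Im (f k x))).
rewrite [X in has_sum _ _ X]complexE; have := has_sumD hr (has_sumZ 'i hi).
by apply: eq_has_sum => k _; rewrite [RHS]complexE.
Qed.

End integral_sums.

(** * The bracket *)

Lemma le_esumZ (R : realType) (I : choiceType) (D : set I) (c : R) (f : I -> R) :
  0 <= c -> (\esum_(i in D) (c * f i)%:E <= c%:E * \esum_(i in D) (f i)%:E)%E.
Proof.
move=> c0; apply: ge_ereal_sup => _ [X [finX XD] <-].
rewrite fsbig_finite//= sumEFin -mulr_sumr EFinM; apply: lee_wpmul2l => //.
apply: ereal_sup_ubound; exists X => //.
by rewrite fsbig_finite//= sumEFin.
Qed.

Section bracket_theory.
Variables (R : realType) (d : nat) (theta : {additive 'cV[int]_d -> 'cV[R]_d}).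
Hypothesis detA : \det (A_theta theta) != 0.
Local Notation Rd := 'cV[R]_d.
Local Notation leb := (lebesgue_cV R d).
Local Notation haar := (haar R d).
Local Notation L0 := (L0 leb).
Local Notation Linf := (Linf haar).
Local Notation fiber := (fiber theta).
Local Notation Y := (Y_theta theta).
Local Notation bracket := (bracket theta).
Implicit Types (p q : L0) (z : torus R d).

Definition codet : R := `|\det (A_theta theta)|^-1.

Lemma codet_gt0 : 0 < codet.
Proof. by rewrite invr_gt0 normr_gt0. Qed.

Lemma bracket_termE (f g : Rd -> R[i]) xi :
  bracket_term theta f g xi = codet%:C * ((f xi)^* * g xi).
Proof. by []. Qed.

Lemma bracket_term_diag (f : Rd -> R[i]) xi :
  bracket_term theta f f xi = codet%:C * (normc (f xi) ^+ 2)%:C.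
Proof. by rewrite bracket_termE conjc_mul_self. Qed.

Lemma bracket_termJ (f g : Rd -> R[i]) xi :
  (bracket_term theta f g xi)^* = bracket_term theta g f xi.
Proof.
rewrite !bracket_termE; case: (f xi) (g xi) => [a b] [a' b'].
apply/eqP; rewrite eq_complex /=; apply/andP; split; apply/eqP; ring.
Qed.

(** The diagonal bracket without its determinant factor, with extended real values so that it makes
    sense before finiteness is known. *)
Definition fiber_sq (f : Rd -> R[i]) z : \bar R :=
  \esum_(xi in fiber z) (normc (f xi) ^+ 2)%:E.

Lemma fiber_sq_ge0 f z : (0 <= fiber_sq f z)%E.
Proof. by apply: esum_ge0 => xi _; rewrite lee_fin sqr_ge0. Qed.

Lemma le_fiber_sq f z xi : fiber z xi ->
  ((normc (f xi) ^+ 2)%:E <= fiber_sq f z)%E.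
Proof.
move=> zxi; apply: esum_ge; exists [set xi]; last by rewrite fsbig_set1.
by split; [exact: finite_set1|move=> _ ->].
Qed.

Lemma eq_fiber_sq (f g : Rd -> R[i]) z : (forall xi, fiber z xi -> f xi = g xi) ->
  fiber_sq f z = fiber_sq g z.
Proof. by move=> fg; apply: eq_esum => xi /fg ->. Qed.

(** Only finiteness of the norm matters for membership, so the square root and the determinant
    factor can be absorbed into the bound. *)
Lemma Y_thetaP p : Y p <->
  exists2 M : R, 0 <= M & \forall z \ae haar, (fiber_sq p z <= M%:E)%E.
Proof.
rewrite /Y_theta /Y_norm /=; set E := ess_sup _ _.
have c0 := codet_gt0; split=> [Eoo|[M M0 pM]].
  have {}Eoo : (E < +oo)%E.
    by apply: (@lty_poweRy _ _ 2^-1) => //; exact: invr_neq0.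
  (* The absolute value gives a nonnegative real above [E], also in the formal case where [E] is
     [-oo] and [fine E] is 0. *)
  exists (codet^-1 * `|fine E|); first by rewrite mulr_ge0 ?invr_ge0 ?(ltW c0).
  have : (E <= `|fine E|%:E)%E.
    move: Eoo; case: E => [r| |]//= _; last by rewrite leNye.
    by rewrite lee_fin ler_norm.
  move=> /ess_supP; apply: filterS => z /=.
  by rewrite EFinM -lee_pdivlMl// invr_gt0.
apply/poweR_lty/(@le_lt_trans _ _ (codet * M)%:E); last exact: ltry.
apply/ess_supP; apply: filterS pM => z pM.
by rewrite EFinM; apply: lee_wpmul2l => //; rewrite lee_fin ltW.
Qed.

(** The elementary bound [a * b <= a ^+ 2 + b ^+ 2] for nonnegative reals replaces Cauchy-Schwarz:
    absolute convergence with a uniform bound is all that is asked. *)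
Lemma esum_bracket_term_le (f g : Rd -> R[i]) z (M N : R) :
  (fiber_sq f z <= M%:E)%E -> (fiber_sq g z <= N%:E)%E ->
  (\esum_(xi in fiber z) (normc (bracket_term theta f g xi))%:E <=
     (codet * (M + N))%:E)%E.
Proof.
move=> fM gN; have c0 := ltW codet_gt0.
apply: (@le_trans _ _ (\esum_(xi in fiber z)
    (codet * (normc (f xi) ^+ 2 + normc (g xi) ^+ 2))%:E)).
  apply: le_esum => xi _.
  rewrite lee_fin bracket_termE !normcM normc_real ger0_norm// ler_wpM2l//.
  rewrite Defs.normcJ.
  have := sqr_ge0 (normc (f xi) - normc (g xi)).
  have := mulr_ge0 (normc_ge0 (f xi)) (normc_ge0 (g xi)).
  by rewrite sqrrB mulr2n; lra.
apply: (le_trans (le_esumZ _ _ c0)); rewrite EFinM; apply: lee_wpmul2l => //.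
under eq_esum do rewrite EFinD.
rewrite esumD; last 2 first.
- by move=> xi _; rewrite lee_fin sqr_ge0.
- by move=> xi _; rewrite lee_fin sqr_ge0.
by rewrite EFinD leeD.
Qed.

(** Termwise, [(a + b) ^+ 2 <= 2 * (a ^+ 2 + b ^+ 2)]. *)
Lemma fiber_sqD (f g : Rd -> R[i]) z (M N : R) :
  (fiber_sq f z <= M%:E)%E -> (fiber_sq g z <= N%:E)%E ->
  (fiber_sq (fun xi => f xi + g xi)%R z <= (2 * (M + N))%:E)%E.
Proof.
move=> fM gN.
apply: (@le_trans _ _ (\esum_(xi in fiber z)
    (2 * (normc (f xi) ^+ 2 + normc (g xi) ^+ 2))%:E)).
  apply: le_esum => xi _; rewrite lee_fin.
  apply: (@le_trans _ _ ((normc (f xi) + normc (g xi)) ^+ 2)).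
    by rewrite lerXn2r ?nnegrE ?addr_ge0 ?normc_ge0// le_normcD.
  have := sqr_ge0 (normc (f xi) - normc (g xi)).
  by rewrite sqrrB sqrrD !mulr2n; lra.
have le02 : 0 <= 2 :> R by [].
apply: (le_trans (le_esumZ _ _ le02)); rewrite EFinM; apply: lee_wpmul2l => //.
under eq_esum do rewrite EFinD.
rewrite esumD; last 2 first.
- by move=> xi _; rewrite lee_fin sqr_ge0.
- by move=> xi _; rewrite lee_fin sqr_ge0.
by rewrite EFinD leeD.
Qed.

Lemma fiber_sqM (f : Rd -> R[i]) (a : Rd -> R[i]) z (M N : R) : 0 <= N ->
  (forall xi, fiber z xi -> normc (a xi) <= N) -> (fiber_sq f z <= M%:E)%E ->
  (fiber_sq (fun xi => f xi * a xi)%R z <= (N ^+ 2 * M)%:E)%E.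
Proof.
move=> N0 aN fM.
apply: (@le_trans _ _ (\esum_(xi in fiber z) (N ^+ 2 * normc (f xi) ^+ 2)%:E)).
  apply: le_esum => xi /aN a1; rewrite lee_fin normcM exprMn mulrC.
  by rewrite ler_wpM2r ?sqr_ge0// lerXn2r ?nnegrE ?normc_ge0.
apply: (le_trans (le_esumZ _ _ (sqr_ge0 N))); rewrite [leRHS]EFinM.
by apply: lee_wpmul2l => //; rewrite lee_fin sqr_ge0.
Qed.

Lemma rsum_fiber (g : Rd -> R) (xi : Rd) :
  rsum (fiber (theta_hat theta xi)) g =
  rsum setT (fun k => g (fiber_point theta xi k)).
Proof.
by rewrite /rsum fiberE// !esum_image// => k l _ _; exact: fiber_point_inj.
Qed.

Lemma csum_fiber (f : Rd -> R[i]) (xi : Rd) :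
  csum (fiber (theta_hat theta xi)) f =
  csum setT (fun k => f (fiber_point theta xi k)).
Proof. by rewrite /csum !rsum_fiber. Qed.

Lemma measurable_fiber_term p q (s : torus R d -> Rd) (k : 'cV[int]_d) :
  measurable_fun setT s ->
  measurable_fun setT (fun z => bracket_term theta p q (fiber_point theta (s z) k)).
Proof.
move=> ms; have mpt : measurable_fun setT (fun z => fiber_point theta (s z) k).
  exact: measurable_addcV.
apply: measurable_mulc; first exact: measurable_cst.
apply: measurable_mulc; last exact: (measurableT_comp (measurable_L0 q) mpt).
apply: measurable_conjc; exact: (measurableT_comp (measurable_L0 p) mpt).
Qed.

(** A measurable section turns the sum over the varying fiber into a sum over the fixed countable
    set [Z^d], which is measurable in [z]; the uniform bound on fibers puts it in [L^oo]. *)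
Lemma bracket_exists p q : Y p -> Y q -> exists b : Linf,
  \forall z \ae haar, has_sum (fiber z) (bracket_term theta p q) (b z).
Proof.
move=> /Y_thetaP[M M0 pM] /Y_thetaP[N N0 qN].
have [s [ms sK]] := theta_section_exists detA.
pose f z := csum setT (fun k => bracket_term theta p q (fiber_point theta (s z) k)).
have mf : measurable_fun setT f.
  by apply: measurable_csum_countable => k; exact: measurable_fiber_term.
have fsum : \forall z \ae haar,
    has_sum (fiber z) (bracket_term theta p q) (f z) /\
    normc (f z) <= codet * (M + N).
  near=> z.
  have zMN := esum_bracket_term_le (near pM z _) (near qN z _).
  (* The sum does not depend on the base point, since [fiber_point] maps [Z^d] bijectively onto the
     fiber. *)
  have fE : f z = csum (fiber z) (bracket_term theta p q).
    by rewrite -(sK z) csum_fiber sK.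
  have hz : has_sum (fiber z) (bracket_term theta p q) (f z).
    by rewrite fE; apply: has_sum_csum; exact: le_lt_trans (zMN _ _) (ltry _).
  by split=> //; apply: has_sum_norm_le hz (zMN _ _).
have fL : mkL0 haar mf \in @Linf_pred _ _ R haar.
  apply/Linf_predP; exists (codet * (M + N)); near=> z.
  rewrite (near (mkL0E haar mf) z)//.
  by have [] : has_sum (fiber z) (bracket_term theta p q) (f z) /\
    normc (f z) <= codet * (M + N) by near: z.
exists (MkLinf fL); near=> z.
rewrite [MkLinf fL z](near (mkL0E haar mf) z)//.
by have [] : has_sum (fiber z) (bracket_term theta p q) (f z) /\
  normc (f z) <= codet * (M + N) by near: z.
Unshelve. all: by end_near. Qed.

Lemma bracketP p q : Y p -> Y q ->
  \forall z \ae haar, has_sum (fiber z) (bracket_term theta p q) (bracket p q z).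
Proof.
by move=> Yp Yq; apply: (@xgetPex _ 0 [set b : Linf | \forall z \ae haar,
  has_sum (fiber z) (bracket_term theta p q) (b z)]); exact: bracket_exists.
Qed.

(** By uniqueness of unconditional sums, identities for the bracket reduce to computations on almost
    every fiber. The existence of [b] ensures that [xget] does not fall back on its default 0. *)
Lemma bracket_eq p q (b : Linf) :
  (\forall z \ae haar, has_sum (fiber z) (bracket_term theta p q) (b z)) ->
  bracket p q = b.
Proof.
move=> hb.
have hbr : \forall z \ae haar,
    has_sum (fiber z) (bracket_term theta p q) (bracket p q z).
  by apply: (@xgetPex _ 0 [set b : Linf | \forall z \ae haar,
    has_sum (fiber z) (bracket_term theta p q) (b z)]); exists b.
apply/LinfP; apply: filterS2 hbr hb => z; exact: has_sum_unique.
Qed.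

End bracket_theory.

(** * Algebraic axioms *)

Lemma L0_scaleAl d (T : measurableType d) (R : realType)
    (mu : {measure set T -> \bar R}) (c : R[i]) (f g : L0 mu) :
  (c *: f) * g = c *: (f * g).
Proof.
apply/L0P; near=> x.
rewrite (near (L0Z c (f * g)) x)// (near (L0M (c *: f) g) x)//.
by rewrite (near (L0M f g) x)// (near (L0Z c f) x)// mulrA.
Unshelve. all: by end_near. Qed.

Section hilbert_module_axioms.
Variables (R : realType) (d : nat) (theta : {additive 'cV[int]_d -> 'cV[R]_d}).
Hypothesis detA : \det (A_theta theta) != 0.
Local Notation Rd := 'cV[R]_d.
Local Notation leb := (lebesgue_cV R d).
Local Notation haar := (haar R d).
Local Notation L0 := (L0 leb).
Local Notation Linf := (Linf haar).
Local Notation fiber := (fiber theta).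
Local Notation Y := (Y_theta theta).
Local Notation bracket := (bracket theta).
Local Notation act := (module_action theta).
Local Notation fiber_sq := (fiber_sq theta).
Local Notation codet := (codet theta).
Implicit Types (p q : L0) (z : torus R d) (a b : Linf).

Lemma Y_theta0 : Y 0.
Proof.
apply/Y_thetaP => //; exists 0 => //; near=> z.
rewrite /fiber_sq esum1// => xi zxi.
rewrite (near (ae_fiber detA (L00 leb)) z _ xi)// normc0 expr0n//.
Unshelve. all: by end_near. Qed.

Lemma Y_thetaD p q : Y p -> Y q -> Y (p + q).
Proof.
move=> /(Y_thetaP detA)[M M0 pM] /(Y_thetaP detA)[N N0 qN].
apply/Y_thetaP => //; exists (2 * (M + N)); first by rewrite mulr_ge0// addr_ge0.
near=> z; rewrite (@eq_fiber_sq _ _ _ _ (fun xi => p xi + q xi)).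
  by apply: fiber_sqD; near: z.
by near: z; exact: (ae_fiber detA (L0D p q)).
Unshelve. all: by end_near. Qed.

(** Serves both the scalar multiplication and the module action, each being multiplication by a
    bounded function. *)
Lemma Y_thetaM p (r : L0) (N : R) : 0 <= N -> Y p ->
  (\forall xi \ae leb, normc (r xi) <= N) -> Y (p * r).
Proof.
move=> N0 /(Y_thetaP detA)[M M0 pM] rN.
apply/Y_thetaP => //; exists (N ^+ 2 * M); first by rewrite mulr_ge0// sqr_ge0.
near=> z; rewrite (@eq_fiber_sq _ _ _ _ (fun xi => p xi * r xi)).
  by apply: fiber_sqM => //; near: z => //; exact: (ae_fiber detA rN).
by near: z; exact: (ae_fiber detA (L0M p r)).
Unshelve. all: by end_near. Qed.

Lemma Y_thetaZ (c : R[i]) p : Y p -> Y (c *: p).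
Proof.
(* Scaling is rewritten as multiplication by a constant function. *)
move=> Yp; have -> : c *: p = p * (c *: (1 : L0)).
  apply/L0P; near=> xi.
  rewrite (near (L0Z c p) xi)// (near (L0M p (c *: (1 : L0))) xi)//.
  by rewrite (near (L0Z c (1 : L0)) xi)// (near (L01 leb) xi)// mulr1 mulrC.
apply: (@Y_thetaM _ _ (normc c)) => //; first exact: normc_ge0.
near=> xi; rewrite (near (L0Z c (1 : L0)) xi)// (near (L01 leb) xi)//.
by rewrite mulr1.
Unshelve. all: by end_near. Qed.

Lemma pull_theta_hatE b :
  \forall xi \ae leb, pull_theta_hat theta b xi = b (theta_hat theta xi).
Proof. exact: mkL0E. Qed.

Lemma module_actionE p b :
  \forall xi \ae leb, act p b xi = p xi * b (theta_hat theta xi).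
Proof.
near=> xi; rewrite (near (L0M p (pull_theta_hat theta b)) xi)//.
by rewrite (near (pull_theta_hatE b) xi).
Unshelve. all: by end_near. Qed.

Lemma Y_theta_act p b : Y p -> Y (act p b).
Proof.
move=> Yp; apply: (Y_thetaM (Linf_norm_ge0 b)) => //.
near=> xi; rewrite (near (pull_theta_hatE b) xi)//.
by near: xi; apply: (ae_theta_hat detA (Linf_normP b)).
Unshelve. all: by end_near. Qed.

Lemma pull_theta_hatD a b :
  pull_theta_hat theta (a + b) = pull_theta_hat theta a + pull_theta_hat theta b.
Proof.
apply/L0P; near=> xi.
rewrite (near (L0D (pull_theta_hat theta a) (pull_theta_hat theta b)) xi)//.
rewrite !(near (pull_theta_hatE _) xi)//.
by near: xi; exact: (ae_theta_hat detA (L0D (\val a) (\val b))).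
Unshelve. all: by end_near. Qed.

Lemma pull_theta_hatM a b :
  pull_theta_hat theta (a * b) = pull_theta_hat theta a * pull_theta_hat theta b.
Proof.
apply/L0P; near=> xi.
rewrite (near (L0M (pull_theta_hat theta a) (pull_theta_hat theta b)) xi)//.
rewrite !(near (pull_theta_hatE _) xi)//.
by near: xi; exact: (ae_theta_hat detA (L0M (\val a) (\val b))).
Unshelve. all: by end_near. Qed.

Lemma pull_theta_hatZ (c : R[i]) b :
  pull_theta_hat theta (c *: b) = c *: pull_theta_hat theta b.
Proof.
apply/L0P; near=> xi.
rewrite (near (L0Z c (pull_theta_hat theta b)) xi)//.
rewrite !(near (pull_theta_hatE _) xi)//.
by near: xi; exact: (ae_theta_hat detA (L0Z c (\val b))).
Unshelve. all: by end_near. Qed.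

Lemma pull_theta_hat1 : pull_theta_hat theta 1 = 1.
Proof.
apply/L0P; near=> xi; rewrite (near (pull_theta_hatE _) xi)//.
rewrite (near (L01 leb) xi)//.
by near: xi; exact: (ae_theta_hat detA (L01 haar)).
Unshelve. all: by end_near. Qed.

Lemma bracketD p q r : Y p -> Y q -> Y r ->
  bracket p (q + r) = bracket p q + bracket p r.
Proof.
move=> Yp Yq Yr; apply: (bracket_eq (theta := theta)); near=> z.
rewrite [X in has_sum _ _ X]
  (near (L0D (\val (bracket p q)) (\val (bracket p r))) z)//.
apply: eq_has_sum (has_sumD (near (bracketP detA Yp Yq) z _)
  (near (bracketP detA Yp Yr) z _)) => // xi zxi.
rewrite !bracket_termE (near (ae_fiber detA (L0D q r)) z _ xi)//.
by rewrite -!mulrDr.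
Unshelve. all: by end_near. Qed.

Lemma bracketZ (c : R[i]) p q : Y p -> Y q ->
  bracket p (c *: q) = c *: bracket p q.
Proof.
move=> Yp Yq; apply: (bracket_eq (theta := theta)); near=> z.
rewrite [X in has_sum _ _ X](near (L0Z c (\val (bracket p q))) z)//.
apply: eq_has_sum (has_sumZ c (near (bracketP detA Yp Yq) z _)) => // xi zxi.
rewrite !bracket_termE (near (ae_fiber detA (L0Z c q)) z _ xi)//.
by ring.
Unshelve. all: by end_near. Qed.

(** The function [b] composed with [theta_hat] is constant on each fiber, so it factors out of the
    sum. *)
Lemma bracket_act p q b : Y p -> Y q -> bracket p (act q b) = bracket p q * b.
Proof.
move=> Yp Yq; apply: (bracket_eq (theta := theta)); near=> z.
rewrite [X in has_sum _ _ X](near (L0M (\val (bracket p q)) (\val b)) z)// mulrC.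
apply: eq_has_sum (has_sumZ _ (near (bracketP detA Yp Yq) z _)) => // xi zxi.
rewrite !bracket_termE (near (ae_fiber detA (module_actionE q b)) z _ xi)//.
rewrite zxi; ring.
Unshelve. all: by end_near. Qed.

Lemma bracket_star p q : Y p -> Y q -> star (bracket p q) = bracket q p.
Proof.
move=> Yp Yq; apply/esym/(bracket_eq (theta := theta)); near=> z.
rewrite [X in has_sum _ _ X](near (L0J (\val (bracket p q))) z)//.
apply: eq_has_sum (has_sumJ (near (bracketP detA Yp Yq) z _)) => // xi zxi.
exact: bracket_termJ.
Unshelve. all: by end_near. Qed.

(** Diagonal terms are multiples of squared moduli, so the sum is a nonnegative real. Positivity,
    definiteness and the norm are all read off from this formula. *)
Lemma bracket_diag p : Y p -> \forall z \ae haar,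
  fiber_sq p z \is a fin_num /\
  bracket p p z = (codet * fine (fiber_sq p z))%:C.
Proof.
move=> Yp; have /(Y_thetaP detA)[M M0 pM] := Yp; near=> z.
have zM : (fiber_sq p z <= M%:E)%E by near: z.
have zfin : fiber_sq p z \is a fin_num.
  by rewrite ge0_fin_numE ?fiber_sq_ge0// (le_lt_trans zM) ?ltry.
split=> //.
have h1 : has_sum (fiber z) (bracket_term theta p p) (bracket p p z).
  by near: z; exact: (bracketP detA).
apply: has_sum_unique h1 _; rewrite rmorphM.
apply: eq_has_sum (has_sumZ _ (has_sum_nneg _ _)) => [xi _|xi _|].
- by rewrite bracket_term_diag.
- by rewrite sqr_ge0.
- by rewrite -ge0_fin_numE ?fiber_sq_ge0.
Unshelve. all: by end_near. Qed.

Lemma bracket_ge0 p : Y p -> cstar_positive (bracket p p).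
Proof.
move=> Yp.
(* The element whose [star] product with itself is the bracket is the pointwise square root; it is
   bounded by the square root of the norm. *)
pose r z : R[i] := (Num.sqrt (complex.Re (bracket p p z)))%:C.
have mr : measurable_fun setT r.
  apply/measurable_funCP; split; last exact: measurable_cst.
  apply: measurable_sqrt.
  by have /measurable_funCP[] := measurable_L0 (\val (bracket p p)).
have rL : mkL0 haar mr \in @Linf_pred _ _ R haar.
  apply/Linf_predP; exists (Num.sqrt (Linf_norm (bracket p p))); near=> z.
  rewrite (near (mkL0E haar mr) z)// normc_real ger0_norm ?sqrtr_ge0//.
  apply: ler_wsqrtr; apply: (le_trans (ler_norm _)).
  by apply: (le_trans (normr_Re _)); near: z; exact: Linf_normP.
exists (MkLinf rL); apply/LinfP; near=> z.
rewrite [RHS](near (L0M (L0_conj (mkL0 haar mr)) (mkL0 haar mr)) z)//.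
rewrite (near (L0J (mkL0 haar mr)) z)// (near (mkL0E haar mr) z)//.
rewrite conjc_mul_self /r normc_real ger0_norm ?sqrtr_ge0//.
have [_ ->] : fiber_sq p z \is a fin_num /\
    bracket p p z = (codet * fine (fiber_sq p z))%:C.
  by near: z; exact: bracket_diag.
rewrite sqr_sqrtr//= mulr_ge0 ?fine_ge0 ?fiber_sq_ge0// ltW//.
exact: codet_gt0.
Unshelve. all: by end_near. Qed.

(** A vanishing sum of squares forces each term on almost every fiber to vanish, and almost every
    point of the space lies on such a fiber. *)
Lemma bracket_eq0 p : Y p -> bracket p p = 0 -> p = 0.
Proof.
move=> Yp p0; have c0 := codet_gt0 detA.
have : \forall z \ae haar, forall xi, fiber z xi -> p xi = 0.
  near=> z => xi zxi.
  have [zfin /esym] : fiber_sq p z \is a fin_num /\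
      bracket p p z = (codet * fine (fiber_sq p z))%:C.
    by near: z; exact: bracket_diag.
  rewrite p0 [RHS](near (L00 haar) z)// => /(congr1 (@complex.Re R))/= /eqP.
  rewrite mulf_eq0 gt_eqF//= => /eqP s0.
  have := le_fiber_sq p zxi; rewrite -(fineK zfin) s0 lee_fin => n0.
  apply: eq0_normc; apply/eqP; rewrite -sqrf_eq0 eq_le n0 sqr_ge0//.
move=> /(ae_theta_hat detA) h; apply/L0P; near=> xi.
rewrite (near (L00 leb) xi)//.
by apply: (near h xi _).
Unshelve. all: by end_near. Qed.

End hilbert_module_axioms.

(** * Completeness *)

Section pointwise_limits.
Variable R : realType.

(* The upper limit is total, and measurable in parameters. *)
Definition lim_sup (v : R^nat) : R := fine (limn_esup (EFin \o v)).

Lemma lim_supP (v : R^nat) : (forall e, 0 < e -> exists k, forall m n,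
    (k <= m)%N -> (k <= n)%N -> `|v m - v n| < e) -> v @ \oo --> lim_sup v.
Proof.
move=> vC; have : cvgn v.
  apply/cauchy_cvgP/cauchy_exP => e e0; have [k vk] := vC _ e0.
  by exists (v k); exists k => // n /= kn; exact: vk.
move=> /cvg_ex[a va]; rewrite (_ : lim_sup v = a)//.
have /cvg_limn_einf_sup[_] : EFin \o v @ \oo --> a%:E.
  by apply/fine_cvgP; split; [exact: nearW|exact: va].
by rewrite /lim_sup => ->.
Qed.

Lemma measurable_lim_sup d (T : measurableType d) (f : nat -> T -> R) :
  (forall n, measurable_fun setT (f n)) ->
  measurable_fun setT (fun x => lim_sup (f^~ x)).
Proof.
move=> mf; apply: (measurableT_comp (fine_measurable measurableT)).
by apply: measurable_fun_limn_esup => n; exact/measurable_EFinP.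
Qed.

Lemma cvg_normc (v : nat -> R[i]) (l : R[i]) :
  (fun n => complex.Re (v n)) @ \oo --> complex.Re l ->
  (fun n => complex.Im (v n)) @ \oo --> complex.Im l ->
  (fun n => normc (v n - l)) @ \oo --> (0 : R).
Proof.
move=> vr vi.
have dist0 (w : R^nat) a : w @ \oo --> a -> `|w n - a| @[n --> \oo] --> (0 : R).
  by move=> /subr_cvg0/cvg_norm; rewrite normr0.
apply: (@squeeze_cvgr _ _ _ _ (cst 0)
  (fun n => `|complex.Re (v n) - complex.Re l| +
            `|complex.Im (v n) - complex.Im l|)).
- by apply: nearW => n; rewrite normc_ge0/= -ReB -ImB normc_le_ReIm.
- exact: cvg_cst.
- by rewrite -[X in _ --> X](addr0 (0 : R)); apply: cvgD; exact: dist0.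
Qed.

(** Upper limits of the real and imaginary parts give a measurable candidate, which is the true
    limit wherever the sequence is Cauchy. *)
Lemma L0_cauchy_limit d (T : measurableType d) (mu : {measure set T -> \bar R})
    (u : nat -> L0 mu) :
  (\forall x \ae mu, forall e, 0 < e -> exists k, forall m n,
    (k <= m)%N -> (k <= n)%N -> normc (u m x - u n x) < e) ->
  exists l : L0 mu, \forall x \ae mu,
    (fun n => normc (u n x - l x)) @ \oo --> (0 : R).
Proof.
move=> uC.
pose l x : R[i] := lim_sup (fun n => complex.Re (u n x)) +i*
                   lim_sup (fun n => complex.Im (u n x)).
have ml : measurable_fun setT l.
  apply/measurable_funCP; split; apply: measurable_lim_sup => n.
    by have /measurable_funCP[] := measurable_L0 (u n).
  by have /measurable_funCP[] := measurable_L0 (u n).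
exists (mkL0 mu ml); apply: filterS2 uC (mkL0E mu ml) => x ux ->.
apply: cvg_normc; apply: lim_supP => e /ux[k uk]; exists k => m n km kn.
  by rewrite -ReB; exact: le_lt_trans (normr_Re _) (uk _ _ km kn).
by rewrite -ImB; exact: le_lt_trans (normr_Im _) (uk _ _ km kn).
Qed.

(** This is the reverse triangle inequality, spelled out for [normc]. *)
Lemma cvg_normcB (v : nat -> R[i]) (a l : R[i]) :
  (fun n => normc (v n - l)) @ \oo --> (0 : R) ->
  (fun n => normc (a - v n)) @ \oo --> normc (a - l).
Proof.
move=> vl; apply/subr_cvg0; apply/cvgr0Pnorm_le => e e0.
move/cvgr0Pnorm_le : vl => /(_ _ e0); apply: filterS => n.
rewrite ger0_norm ?normc_ge0// => vn; apply: le_trans vn.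
have := le_normcD (a - v n) (v n - l); rewrite subrKA => h1.
have := le_normcB (a - l) (v n - l).
rewrite (_ : a - l - (v n - l) = a - v n); last by ring.
by move=> h2; rewrite ler_norml; lra.
Qed.

End pointwise_limits.

Section completeness.
Variables (R : realType) (d : nat) (theta : {additive 'cV[int]_d -> 'cV[R]_d}).
Hypothesis detA : \det (A_theta theta) != 0.
Local Notation Rd := 'cV[R]_d.
Local Notation leb := (lebesgue_cV R d).
Local Notation haar := (haar R d).
Local Notation L0 := (L0 leb).
Local Notation fiber := (fiber theta).
Local Notation Y := (Y_theta theta).
Local Notation bracket := (bracket theta).
Local Notation fiber_sq := (fiber_sq theta).
Local Notation codet := (codet theta).
Implicit Types (p q : L0) (z : torus R d).

Definition Y_rnorm p : R := Num.sqrt (cnorm (bracket p p)).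

(** Together with [Y_rnorm_le], it identifies the square of the module norm with the essential
    supremum of [codet] times [fiber_sq]. *)
Lemma fiber_sq_le_norm p : Y p -> \forall z \ae haar,
  (fiber_sq p z <= (codet^-1 * Y_rnorm p ^+ 2)%:E)%E.
Proof.
move=> Yp; have c0 := codet_gt0 detA; near=> z.
have [zfin bE] : fiber_sq p z \is a fin_num /\
    bracket p p z = (codet * fine (fiber_sq p z))%:C.
  by near: z; exact: bracket_diag.
have : normc (bracket p p z) <= Linf_norm (bracket p p).
  by near: z; exact: Linf_normP.
rewrite bE normc_real -[X in (X <= _)%E](fineK zfin) lee_fin.
rewrite /Y_rnorm sqr_sqrtr ?Linf_norm_ge0//.
rewrite ger0_norm; first by rewrite ler_pdivlMl.
by rewrite mulr_ge0 ?(ltW c0) ?fine_ge0 ?fiber_sq_ge0.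
Unshelve. all: by end_near. Qed.

Lemma Y_rnorm_le p (e : R) : 0 <= e ->
  (\forall z \ae haar, (fiber_sq p z <= (codet^-1 * e ^+ 2)%:E)%E) ->
  Y p /\ Y_rnorm p <= e.
Proof.
move=> e0 pe; have c0 := codet_gt0 detA.
have Yp : Y p.
  apply/Y_thetaP => //; exists (codet^-1 * e ^+ 2) => //.
  by rewrite mulr_ge0 ?sqr_ge0// invr_ge0 ltW.
split=> //; rewrite -(ger0_norm e0) -sqrtr_sqr; apply: ler_wsqrtr.
apply: Linf_norm_le; near=> z.
have [zfin ->] : fiber_sq p z \is a fin_num /\
    bracket p p z = (codet * fine (fiber_sq p z))%:C.
  by near: z; exact: bracket_diag.
have : (fiber_sq p z <= (codet^-1 * e ^+ 2)%:E)%E by near: z.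
rewrite -{1}(fineK zfin) lee_fin ler_pdivlMl// => h.
rewrite normc_real ger0_norm//.
by rewrite mulr_ge0 ?(ltW c0) ?fine_ge0 ?fiber_sq_ge0.
Unshelve. all: by end_near. Qed.

(** Fatou's argument: on a finite part of the fiber the sum passes to the limit and keeps the bound
    [M], and the [\esum] is the supremum over finite parts. *)
Lemma fiber_sq_limit (u : nat -> L0) (f g : Rd -> R[i]) z (M : R) k :
  (forall xi, fiber z xi -> (fun n => normc (u n xi - g xi)) @ \oo --> (0 : R)) ->
  (forall n, (k <= n)%N ->
    (fiber_sq (fun xi => f xi - u n xi)%R z <= M%:E)%E) ->
  (fiber_sq (fun xi => f xi - g xi)%R z <= M%:E)%E.
Proof.
move=> ug uM; apply: ge_ereal_sup => _ [X [finX Xz] <-].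
rewrite fsbig_finite//= sumEFin lee_fin.
set s := \sum_(xi <- _) _.
have cs : (fun n => \sum_(xi <- fset_set X) normc (f xi - u n xi) ^+ 2) @ \oo --> s.
  rewrite /s; have : {subset (fset_set X : seq _) <= fset_set X} by [].
  elim: (fset_set X : seq _) => [_|xi r IH xir].
    by under eq_fun do rewrite big_nil; rewrite big_nil; exact: cvg_cst.
  under eq_fun do rewrite big_cons; rewrite big_cons; apply: cvgD.
    have zxi : fiber z xi.
      by apply: Xz; have := xir _ (mem_head _ _); rewrite in_fset_set// inE.
    have h := cvg_normcB (a := f xi) (ug _ zxi).
    by under eq_fun do rewrite expr2; rewrite expr2; exact: cvgM.
  by apply: IH => eta etar; apply: xir; rewrite inE etar orbT.
rewrite -(cvg_lim _ cs)//; apply: limr_le; first by apply/cvg_ex; exists s.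
exists k => // n /= /uM; rewrite -lee_fin; apply: le_trans.
apply: ereal_sup_ubound; exists X => //.
by rewrite fsbig_finite//= sumEFin.
Qed.

Lemma Y_theta_complete (u : nat -> L0) : (forall n, Y (u n)) ->
  (forall e, 0 < e -> exists k, forall m n, (k <= m)%N -> (k <= n)%N ->
     Y_rnorm (u m - u n) < e) ->
  exists2 l, Y l & Y_rnorm (u n - l) @[n --> \oo] --> (0 : R).
Proof.
move=> Yu uC; have c0 := codet_gt0 detA.
have YB m n : Y (u m - u n).
  by rewrite -scaleN1r; apply: Y_thetaD => //; exact: Y_thetaZ.
have uE : \forall xi \ae leb, forall m n, (u m - u n : L0) xi = u m xi - u n xi.
  apply: ae_foralln => m; apply: ae_foralln => n; near=> xi.
  rewrite (near (L0D (u m) (- u n)) xi)//.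
  by rewrite (near (L0N (u n)) xi).
(* There are countably many pairs of indices, so a single null set of fibers serves them all. *)
have uN : \forall z \ae haar, forall m n,
    (fiber_sq (fun xi => u m xi - u n xi)%R z <=
      (codet^-1 * Y_rnorm (u m - u n) ^+ 2)%:E)%E.
  apply: ae_foralln => m; apply: ae_foralln => n; near=> z.
  rewrite -(@eq_fiber_sq _ _ _ (u m - u n : L0)).
    by near: z; exact: fiber_sq_le_norm.
  by move=> xi zxi; apply: (near (ae_fiber detA uE) z _ xi).
have [l ul] : exists l : L0, \forall xi \ae leb,
    (fun n => normc (u n xi - l xi)) @ \oo --> (0 : R).
  apply: L0_cauchy_limit.
  apply: filterS (ae_theta_hat detA uN) => xi uxi e e0.
  (* The factor [Num.sqrt codet] compensates the [codet^-1] of [uN], so that the pointwise bound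
     comes out as [e]. *)
  have e1 : 0 < e * Num.sqrt codet by rewrite mulr_gt0// sqrtr_gt0.
  have [k uk] := uC _ e1; exists k => m n km kn.
  have := le_trans (le_fiber_sq (fun xi => u m xi - u n xi)
    (erefl : fiber (theta_hat theta xi) xi)) (uxi m n).
  rewrite lee_fin ler_pdivlMl// => h.
  have {}h : codet * normc (u m xi - u n xi) ^+ 2 < (e * Num.sqrt codet) ^+ 2.
    apply: (le_lt_trans h); rewrite ltrXn2r// ?nnegrE ?sqrtr_ge0 ?(ltW e1)//.
    exact: uk.
  move: h; rewrite exprMn sqr_sqrtr ?(ltW c0)// mulrC ltr_pM2r//.
  by rewrite ltr_pXn2r ?nnegrE ?normc_ge0 ?(ltW e0).
(* With [n] fixed, the fiberwise bound on [u n - u m] passes to the limit in [m]; it yields both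
   membership in [Y] and the norm estimate. *)
have key e k : 0 < e ->
    (forall m n, (k <= m)%N -> (k <= n)%N -> Y_rnorm (u m - u n) < e) ->
    forall n, (k <= n)%N -> Y (u n - l) /\ Y_rnorm (u n - l) <= e.
  move=> e0 uk n kn; apply: Y_rnorm_le; first exact: ltW.
  near=> z.
  rewrite (@eq_fiber_sq _ _ _ (u n - l : L0) (fun xi => u n xi - l xi)); last first.
    move=> xi zxi; rewrite (near (ae_fiber detA (L0D (u n) (- l))) z _ xi)//.
    by rewrite (near (ae_fiber detA (L0N l)) z _ xi).
  apply: (@fiber_sq_limit u _ _ _ _ k).
    by near: z; exact: (ae_fiber detA ul).
  have uNz : forall m, (fiber_sq (fun xi => u n xi - u m xi)%R z <=
      (codet^-1 * Y_rnorm (u n - u m) ^+ 2)%:E)%E.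
    by near: z; apply: filterS uN => z; exact.
  move=> m km; apply: (le_trans (uNz m)).
  rewrite lee_fin ler_wpM2l ?invr_ge0 ?(ltW c0)//.
  rewrite lerXn2r ?nnegrE ?sqrtr_ge0 ?(ltW e0)//.
  by apply/ltW/uk.
exists l.
  have [k uk] := uC _ ltr01; have [YBl _] := key _ _ ltr01 uk _ (leqnn k).
  (* Membership of the limit follows from [l = u k - (u k - l)]. *)
  rewrite -[l](subKr (u k)) -[- _]scaleN1r; apply: Y_thetaD => //.
  exact: Y_thetaZ.
apply/cvgr0Pnorm_le => e e0; have [k uk] := uC _ e0; exists k => // n /= kn.
rewrite ger0_norm ?sqrtr_ge0//.
by have [] := key _ _ e0 uk _ kn.
Unshelve. all: by end_near. Qed.

End completeness.

(** * Weak* convergence *)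

Section complex_integrals.
Context d (T : measurableType d) (R : realType).
Variable mu : probability T R.
Implicit Types f g : T -> R[i].

Lemma cintegrable_le f (h : T -> R) : measurable_fun setT f ->
  mu.-integrable setT (EFin \o h) -> (\forall x \ae mu, normc (f x) <= h x) ->
  cintegrable mu f.
Proof.
move=> /measurable_funCP[mr mi] ih fh.
have bound (g : T -> R) : measurable_fun setT g ->
    (forall x, `|g x| <= normc (f x)) -> mu.-integrable setT (EFin \o g).
  move=> mg gf; apply/integrableP; split; first exact/measurable_EFinP.
  have /integrableP[mh] := ih; apply: le_lt_trans.
  apply: ae_ge0_le_integral => //.
  - exact/measurableT_comp/measurable_EFinP.
  - exact: measurableT_comp.
  - apply: filterS fh => x fx _ /=; rewrite lee_fin.
    exact: le_trans (gf x) (le_trans fx (ler_norm _)).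
by split; apply: bound => // x; [exact: normr_Re|exact: normr_Im].
Qed.

Lemma cintegrable_measurable f : cintegrable mu f -> measurable_fun setT f.
Proof.
move=> [/integrableP[/measurable_EFinP mr _] /integrableP[/measurable_EFinP mi _]].
exact/measurable_funCP.
Qed.

Lemma integrable_normc f : cintegrable mu f ->
  mu.-integrable setT (EFin \o (fun x => normc (f x))).
Proof.
move=> fi; have mf := cintegrable_measurable fi.
have [ri ii] := fi.
have abs2 := integrableD measurableT (integrable_abse ri) (integrable_abse ii).
apply: le_integrable abs2 => //.
  exact/measurable_EFinP/measurable_normc.
move=> x _ /=; rewrite lee_fin.
rewrite [leLHS]ger0_norm ?normc_ge0// (le_trans _ (ler_norm _))//.
exact: normc_le_ReIm.
Qed.

Lemma ae_eq_cintegral f g : measurable_fun setT f -> measurable_fun setT g ->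
  (\forall x \ae mu, f x = g x) -> cintegral mu f = cintegral mu g.
Proof.
move=> /measurable_funCP[fr fi] /measurable_funCP[gr gi] fg.
congr (_ +i* _); congr fine; apply: ae_eq_integral => //;
  try exact/measurable_EFinP.
  by apply: filterS fg => x ->.
by apply: filterS fg => x ->.
Qed.

Lemma measurable_sumc (I : Type) (s : seq I) (f : I -> T -> R[i]) :
  (forall i, measurable_fun setT (f i)) ->
  measurable_fun setT (fun x => \sum_(i <- s) f i x).
Proof.
move=> mf; elim: s => [|i s IH].
  by under eq_fun do rewrite big_nil; exact: measurable_cst.
by under eq_fun do rewrite big_cons; exact: measurable_addc.
Qed.

Lemma cintegral_sum (I : Type) (s : seq I) (f : I -> T -> R[i]) :
  (forall i, cintegrable mu (f i)) ->
  cintegral mu (fun x => \sum_(i <- s) f i x) = \sum_(i <- s) cintegral mu (f i).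
Proof.
move=> fi; have Rint (g : I -> T -> R) :
    (forall i, mu.-integrable setT (EFin \o g i)) ->
    mu.-integrable setT (EFin \o (fun x => \sum_(i <- s) g i x)) /\
    \int[mu]_x (\sum_(i <- s) g i x) = \sum_(i <- s) \int[mu]_x g i x.
  move=> gi; elim: s => [|i s [IH1 IH2]].
    split; first by under eq_fun do rewrite big_nil; exact: integrable0.
    by under eq_Rintegral do rewrite big_nil; rewrite big_nil Rintegral_cst// mul0r.
  split.
    rewrite (_ : _ \o _ = (EFin \o g i) \+ (EFin \o (fun x => \sum_(i <- s) g i x))).
      exact: integrableD.
    by apply/funext => x /=; rewrite big_cons.
  under eq_Rintegral do rewrite big_cons.
  by rewrite RintegralD// big_cons IH2.
have [_ hr] := Rint _ (fun i => (fi i).1).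
have [_ hi] := Rint _ (fun i => (fi i).2).
have ReS x : complex.Re (\sum_(i <- s) f i x) = \sum_(i <- s) complex.Re (f i x).
  by elim/big_rec2 : _ => // i a b _ <-; case: (f i x) b => ? ? [].
have ImS x : complex.Im (\sum_(i <- s) f i x) = \sum_(i <- s) complex.Im (f i x).
  by elim/big_rec2 : _ => // i a b _ <-; case: (f i x) b => ? ? [].
rewrite /cintegral.
under eq_Rintegral do rewrite ReS.
rewrite hr; under eq_Rintegral do rewrite ImS.
rewrite hi; by elim/big_rec3 : _ => // i a b c _ <-.
Qed.

(** The representative of a sum of classes is the sum of the representatives only off a null set,
    which collects one exceptional set per addition. *)
Lemma Linf_sumE (I : Type) (s : seq I) (u : I -> Linf mu) :
  \forall x \ae mu, (\sum_(i <- s) u i : Linf mu) x = \sum_(i <- s) u i x.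
Proof.
elim: s => [|i s IH].
  by rewrite big_nil; apply: filterS (L00 mu) => x ->; rewrite big_nil.
rewrite big_cons; near=> x; rewrite big_cons.
rewrite [LHS](near (L0D (\val (u i)) (\val (\sum_(j <- s) u j))) x)//.
by congr (_ + _); near: x.
Unshelve. all: by end_near. Qed.

(** Tested against an integrable [g], the series of absolute values is dominated by a constant
    multiple of [normc (g x)], so sum and integral can be exchanged. *)
Lemma weak_star_sum_bounded (I : countType) (u : I -> Linf mu) (b : Linf mu)
    (M : R) :
  (\forall x \ae mu, has_sum setT (fun i => u i x) (b x) /\
     (\esum_(i in setT) (normc (u i x))%:E <= M%:E)%E) ->
  weak_star_sum u b.
Proof.
move=> uM g gi; have mg := cintegrable_measurable gi.
have ngi := integrable_normc gi.
pose f i x := u i x * g x.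
have mf i : measurable_fun setT (f i).
  by apply: measurable_mulc => //; exact: measurable_L0.
have mnf i : measurable_fun setT (fun x => (normc (f i x))%:E).
  exact/measurable_EFinP/measurable_normc.
have fM : \forall x \ae mu,
    (\esum_(i in setT) (normc (f i x))%:E <= (`|M| * normc (g x))%:E)%E.
  apply: filterS uM => x [_ ux].
  apply: (@le_trans _ _ (\esum_(i in setT) (normc (g x) * normc (u i x))%:E)).
    by apply: le_esum => i _; rewrite lee_fin normcM mulrC.
  apply: (le_trans (le_esumZ _ _ (normc_ge0 _))).
  rewrite mulrC [leRHS]EFinM; apply: lee_wpmul2l.
    by rewrite lee_fin normc_ge0.
  by apply: (le_trans ux); rewrite lee_fin ler_norm.
have Mg : mu.-integrable setT (EFin \o (fun x => `|M| * normc (g x))).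
  by have := integrableZl measurableT `|M| ngi.
have foo : (\int[mu]_x (\esum_(i in setT) (normc (f i x))%:E) < +oo)%E.
  have /integrableP[mMg] := Mg; apply: le_lt_trans.
  apply: ae_ge0_le_integral => //.
  - by move=> x _; apply: esum_ge0 => i _; rewrite lee_fin normc_ge0.
  - by apply: measurable_esum_countable => // i x; rewrite lee_fin normc_ge0.
  - exact: measurableT_comp.
  - apply: filterS fM => x fx _; apply: (le_trans fx) => /=.
    by rewrite lee_fin ler_norm.
have fi i : cintegrable mu (f i).
  apply: cintegrable_le Mg _ => //; apply: filterS fM => x; rewrite -lee_fin.
  apply: le_trans; apply: esum_ge; exists [set i]; last by rewrite fsbig_set1.
  by split; [exact: finite_set1|].
have := has_sum_cintegral mf foo.
(* Almost everywhere the pointwise sum of the [f i] is [b x * g x], by uniqueness of sums. *)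
rewrite (_ : cintegral mu (fun x => csum _ _) =
  cintegral mu (fun x => b x * g x)); last first.
  apply: ae_eq_cintegral.
  - exact: measurable_csum_countable.
  - by apply: measurable_mulc => //; exact: measurable_L0.
  apply: filterS2 uM fM => x [ux _] fx.
  apply: has_sum_unique (has_sum_csum _) _.
    by apply: le_lt_trans fx _; exact: ltry.
  rewrite mulrC; apply: eq_has_sum (has_sumZ (g x) ux) => i _.
  by rewrite /f mulrC.
move=> h e /h[F FT hF]; exists F => // G FG GT.
(* The partial sums tested in the weak* topology are integrals of sums of classes, equal to sums of
   integrals by [Linf_sumE] and linearity. *)
rewrite (_ : cintegral _ _ = \sum_(i <- G) cintegral mu (f i)); first exact: hF.
rewrite -cintegral_sum//; apply: ae_eq_cintegral.
- by apply: measurable_mulc => //; exact: measurable_L0.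
- exact: measurable_sumc.
by apply: filterS (Linf_sumE G u) => x ->; rewrite mulr_suml.
Qed.

End complex_integrals.

(** * The bracket as a weak* convergent series *)

Section series.
Variables (R : realType) (d : nat) (theta : {additive 'cV[int]_d -> 'cV[R]_d}).
Hypothesis detA : \det (A_theta theta) != 0.
Local Notation leb := (lebesgue_cV R d).
Local Notation haar := (haar R d).
Local Notation L0 := (L0 leb).
Local Notation Y := (Y_theta theta).

Lemma bracket_series_weak_star (p q : L0) (s : torus R d -> 'cV[R]_d) :
  Y p -> Y q -> theta_section theta s ->
  exists2 u : 'cV[int]_d -> Linf haar,
    bracket_series theta p q s u & weak_star_sum u (bracket theta p q).
Proof.
move=> Yp Yq [ms sK].
have /(Y_thetaP detA)[M M0 pM] := Yp; have /(Y_thetaP detA)[N N0 qN] := Yq.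
pose v k z := bracket_term theta p q (fiber_point theta (s z) k).
have mv k : measurable_fun setT (v k) by exact: measurable_fiber_term.
have sum_le : \forall z \ae haar,
    (\esum_(k in setT) (normc (v k z))%:E <= (codet theta * (M + N))%:E)%E.
  (* The sum over [Z^d] is carried to the fiber of [z], where the bound for bracket terms
     applies. *)
  near=> z; rewrite -(@esum_image _ _ _ setT (fiber_point theta (s z))
    (fun xi => (normc (bracket_term theta p q xi))%:E)); last first.
    by move=> k l _ _; exact: fiber_point_inj.
  rewrite -fiberE// sK.
  by apply: esum_bracket_term_le => //; near: z.
have vL k : mkL0 haar (mv k) \in @Linf_pred _ _ R haar.
  apply/Linf_predP; exists (codet theta * (M + N)).
  apply: filterS2 sum_le (mkL0E haar (mv k)) => z vz ->.
  rewrite -lee_fin; apply: le_trans vz; apply: esum_ge.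
  exists [set k]; last by rewrite fsbig_set1.
  by split; [exact: finite_set1|].
exists (fun k => MkLinf (vL k)); first by move=> k; exact: mkL0E.
apply: (@weak_star_sum_bounded _ _ _ _ _ _ _ (codet theta * (M + N))).
(* Countability of [Z^d] allows one null set outside which all chosen representatives take the
   prescribed values. *)
have uE : \forall z \ae haar, forall k, MkLinf (vL k) z = v k z.
  by apply: ae_forall_countable => k; exact: mkL0E.
near=> z; have uEz : forall k, MkLinf (vL k) z = v k z by near: z.
have vz : (\esum_(k in setT) (normc (v k z))%:E <= (codet theta * (M + N))%:E)%E.
  by near: z.
split; last by under eq_esum do rewrite uEz.
have bz : has_sum (fiber theta z) (bracket_term theta p q) (bracket theta p q z).
  by near: z; exact: bracketP.
rewrite (_ : bracket theta p q z = csum setT (v^~ z)).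
  under [X in has_sum _ X _]eq_fun do rewrite uEz.
  by apply: has_sum_csum; exact: le_lt_trans vz (ltry _).
(* The sum along the section is the sum over the whole fiber, hence the value of the bracket. *)
rewrite -[RHS](csum_fiber detA _ (s z)) sK.
apply: has_sum_unique bz (has_sum_csum _).
apply: (@le_lt_trans _ _ (codet theta * (M + N))%:E); last exact: ltry.
by apply: esum_bracket_term_le => //; near: z.
Unshelve. all: by end_near. Qed.

End series.

Theorem theorem5p3 (R : realType) (d : nat)
    (theta : {additive 'cV[int]_d -> 'cV[R]_d})
    (theta_emb : Zd_embedding theta) :
  [/\ forall p q : L0 (lebesgue_cV R d),
        Y_theta theta p -> Y_theta theta q ->
        \forall zeta \ae haar R d,
          has_sum (fiber theta zeta) (bracket_term theta p q)
            (bracket theta p q zeta),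
      forall (p q : L0 (lebesgue_cV R d)) (s : torus R d -> 'cV[R]_d),
        Y_theta theta p -> Y_theta theta q -> theta_section theta s ->
        exists2 u : 'cV[int]_d -> Linf (haar R d),
          bracket_series theta p q s u & weak_star_sum u (bracket theta p q)
    & hilbert_module (Y_theta theta) (module_action theta) (bracket theta)].
Proof.
have detA := det_A_theta_neq0 theta_emb.
split; [exact: bracketP|exact: bracket_series_weak_star|split].
- exact: Y_theta0.
- exact: Y_thetaD.
- by move=> c x; exact: Y_thetaZ.
- by move=> x a; exact: Y_theta_act.
- by move=> x y a _ _; rewrite /module_action mulrDl.
- by move=> x a b _; rewrite /module_action pull_theta_hatD// mulrDr.
- by move=> x a b _; rewrite /module_action pull_theta_hatM// mulrA.
- by move=> x _; rewrite /module_action pull_theta_hat1// mulr1.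
- by move=> c x a _; rewrite /module_action L0_scaleAl.
- move=> c x a _; rewrite /module_action pull_theta_hatZ// mulrC L0_scaleAl.
  by rewrite [in RHS]mulrC.
- exact: bracketD.
- exact: bracketZ.
- by move=> x y a; exact: bracket_act.
- exact: bracket_star.
- exact: bracket_ge0.
- exact: bracket_eq0.
- exact: Y_theta_complete.
Qed.
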